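(* For every function $f\in A^2(D)$, $$\sum_{n=0}^{\infty}\frac{2^n}{(2n+1)!}\int_0^{1/2}x^{2n+1}\big(|f^{(n)}(x)|^2+|f^{(n)}(1-x)|^2\big)dx\le 2\int_\Omega|f(z)|^2\,dA(z)\le 2\int_D|f(z)|^2\,dA(z).$$
   Context: $D=\{z\in\mathbb{C}: |\mathrm{Re}\,z-\tfrac12|+|\mathrm{Im}\,z|<\tfrac12\}$ is the open square one of whose diagonals is $(0,1)$. $D(c,r)$ denotes the open disk of center $c$ and radius $r$, and $$\Omega=\bigcup_{0<x\le 1/2}D\big(x,x/\sqrt2\big)\ \cup\bigcup_{1/2<x<1}D\big(x,(1-x)/\sqrt2\big).$$ $dA(z)=dx\,dy$ is planar Lebesgue measure. For a domain $U\subset\mathbb{C}$, the Bergman space $A^2(U)$ is the space of holomorphic functions $f$ on $U$ with $\int_U|f|^2\,dA<\infty$. *)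

(* Defs.v *)
From mathcomp Require Import all_boot all_order all_algebra complex.
From mathcomp Require Import all_classical all_reals all_analysis.

Set Implicit Arguments.
Unset Strict Implicit.
Unset Printing Implicit Defensive.

Import Order.TTheory GRing.Theory Num.Theory.
Import numFieldNormedType.Exports.

Local Open Scope classical_set_scope.
Local Open Scope complex_scope.
Local Open Scope ring_scope.

(* The real-valued modulus; the library norm `|z| on R[i] is valued in R[i]. *)
Definition cmod (R : realType) (z : R[i]) : R := complex.Re `|z|.

Definition disk (R : realType) (c : R[i]) (r : R) : set R[i] :=
  [set z | cmod (z - c) < r].

Definition squareD (R : realType) : set R[i] :=
  [set z | `|complex.Re z - 2^-1| + `|complex.Im z| < 2^-1].

Definition Omega (R : realType) : set R[i] :=
  (\bigcup_(x in [set x : R | 0 < x <= 2^-1]) disk x%:C (x / Num.sqrt 2)) `|`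
  (\bigcup_(x in [set x : R | 2^-1 < x < 1]) disk x%:C ((1 - x) / Num.sqrt 2)).

Arguments squareD R : clear implicits.
Arguments Omega R : clear implicits.

(* dA is the product of two copies of Lebesgue measure, R[i] being identified
   with R * R by (x, y) |-> x +i* y. *)
Definition area_integral (R : realType) (U : set R[i]) (g : R[i] -> R) :
    \bar R :=
  (\int[lebesgue_measure \x lebesgue_measure]_(p in
      [set p : R * R | U (p.1 +i* p.2)]) (g (p.1 +i* p.2))%:E)%E.

(* R[i] carries its topology and its module structure over itself through the
   regular module R[i]^o, so these are complex derivatives.  Functions on an
   open set U are represented by total functions, only the values on U matter. *)
Definition holomorphic_on (R : realType) (U : set R[i]) (f : R[i] -> R[i]) :=
  forall z, U z -> derivable (f : R[i]^o -> R[i]^o) z 1.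

Definition cderiv (R : realType) (n : nat) (f : R[i] -> R[i]) : R[i] -> R[i] :=
  derive1n n (f : R[i] -> R[i]^o).

Definition bergman (R : realType) (U : set R[i]) : set (R[i] -> R[i]) :=
  [set f | holomorphic_on U f /\
           (area_integral U (fun z => (cmod (f z) ^+ 2)%R) < +oo)%E].

(* Main.v *)
(* For 0 < x <= 1/2 and k = x or k = 1 - x, the disk D(k, x/sqrt 2) lies in Omega.
   Bessel's inequality on the circles |z - k| = r, integrated against
   r dr / sqrt(x^2 - 2 r^2), and the moments
     2 \int_0^{x/sqrt 2} r^(2n+1) / sqrt(x^2 - 2 r^2) dr
        = 2^n x^(2n+1) n!^2 / (2n+1)!
   give
     \sum_n 2^n/(2n+1)! x^(2n+1) |f^(n)(k)|^2
       <= 1/pi \int_{D(k, x/sqrt 2)} |f|^2 / sqrt(x^2 - 2 |z - k|^2) dA.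
   Integrate over x and exchange the integrals.  With c = Re z or 1 - Re z,
     x^2 - 2 |z - k|^2 = (2 c^2 - 2 (Im z)^2) - (x - 2 c)^2,
   so the inner integral over x is an arcsine integral, at most pi.  Each of the
   two choices of k is therefore bounded by the integral of |f|^2 over Omega.

   Holomorphy is pointwise complex differentiability, so Cauchy's formula for the
   derivatives is obtained from Goursat's theorem, proved by bisection for the
   pull-back of f(z) dz along a homotopy of circles. *)
From HB Require Import structures.
Require Import Defs.
From mathcomp Require Import all_boot all_order all_algebra complex.
From mathcomp Require Import all_classical all_reals all_analysis.
From mathcomp Require Import measurable_realfun ring lra.

Set Implicit Arguments.
Unset Strict Implicit.
Unset Printing Implicit Defensive.

Import Order.TTheory GRing.Theory Num.Theory.
Import numFieldNormedType.Exports.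

Local Open Scope classical_set_scope.
Local Open Scope complex_scope.
Local Open Scope ring_scope.

(** * Modulus and complex derivative *)

Section ComplexBasics.
Variable R : realType.
Implicit Types (z w : R[i]) (x y : R).

(** The radius x / sqrt 2 and the moving centre are tied together: the centre travels along the real
    axis at unit speed in x, so the radicand x^2 - 2 |z - k|^2 is a quadratic in x with leading
    coefficient 1 - 2 = -1. This is what produces an arcsine density in x, with total mass bounded
    independently of z. The bound pi cancels the 1/pi of the disk estimate exactly, so no constant
    is lost and the 2 of the theorem merely counts the two families of centres. The main estimate
    works with nonnegative integrands and extended real integrals, so Tonelli and monotone
    convergence apply directly. The obstacle is the inverse square root singularity. It is met by
    one-sided forms of the fundamental theorem of calculus: the moments are only bounded from below
    and the arcsine integral only from above. Polar coordinates are themselves derived from Tonelli,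
    by integrating along the lines through a point. *)

Lemma cmod_sqr z : cmod z ^+ 2 = complex.Re z ^+ 2 + complex.Im z ^+ 2.
Proof. by case: z => a b /=; rewrite sqr_sqrtr// addr_ge0// sqr_ge0. Qed.

Lemma cmod_normc z : cmod z = ComplexField.Normc.normc z.
Proof. by case: z. Qed.

Lemma cmod_norm z : `|z| = (cmod z)%:C.
Proof. by case: z. Qed.

Lemma cmod_ge0 z : 0 <= cmod z.
Proof. by case: z => a b /=; exact: sqrtr_ge0. Qed.

Lemma cmodM z w : cmod (z * w) = cmod z * cmod w.
Proof. by rewrite !cmod_normc ComplexField.Normc.normcM. Qed.

Lemma cmodV z : cmod z^-1 = (cmod z)^-1.
Proof. by rewrite !cmod_normc ComplexField.Normc.normcV. Qed.

Lemma cmodN z : cmod (- z) = cmod z.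
Proof. by rewrite /cmod normrN. Qed.

Lemma cmodD z w : cmod (z + w) <= cmod z + cmod w.
Proof. by have := ler_normD z w; rewrite !cmod_norm -rmorphD lecR. Qed.

Lemma cmodB z w : cmod (z - w) <= cmod z + cmod w.
Proof. by rewrite -[cmod w]cmodN; exact: cmodD. Qed.

Lemma cmodBC z w : cmod (z - w) = cmod (w - z).
Proof. by rewrite -cmodN opprB. Qed.

Lemma cmod_real x : cmod x%:C = `|x|.
Proof. by rewrite /cmod normc_def /= expr0n addr0 sqrtr_sqr. Qed.

Lemma cmod0 : cmod (0 : R[i]) = 0.
Proof. by rewrite /cmod normr0. Qed.

Lemma cmod1 : cmod (1 : R[i]) = 1.
Proof. by rewrite /cmod normr1. Qed.

Lemma cmod_eq0 z : (cmod z == 0) = (z == 0).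
Proof. by rewrite -(normr_eq0 z) cmod_norm -(inj_eq (@complexI R)). Qed.

Lemma cmod_gt0 z : (0 < cmod z) = (z != 0).
Proof. by rewrite lt_neqAle cmod_ge0 andbT eq_sym cmod_eq0. Qed.

Lemma cmodX z n : cmod (z ^+ n) = cmod z ^+ n.
Proof. by elim: n => [|n IH]; rewrite ?expr0 ?cmod1// !exprS cmodM IH. Qed.

Lemma mulcJ z : z * z^* = (cmod z ^+ 2)%:C.
Proof. by rewrite -sqr_normc cmod_norm rmorphXn. Qed.

Lemma Re_le_cmod z : `|complex.Re z| <= cmod z.
Proof. by have := normc_ge_Re z; rewrite cmod_norm lecR. Qed.

Lemma Im_le_cmod z : `|complex.Im z| <= cmod z.
Proof.
by case: z => a b; rewrite /= -(sqrtr_sqr b) ler_wsqrtr// lerDr sqr_ge0.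
Qed.

Lemma cmod_le_ReIm z : cmod z <= `|complex.Re z| + `|complex.Im z|.
Proof.
rewrite [z in cmod z]complexE (le_trans (cmodD _ _))// cmodM !cmod_real.
by rewrite (_ : cmod 'i = 1) ?mul1r// /cmod normc_def /= expr0n expr1n add0r sqrtr1.
Qed.

Lemma Re_add z w : complex.Re (z + w) = complex.Re z + complex.Re w.
Proof. by case: z; case: w. Qed.

Lemma Im_add z w : complex.Im (z + w) = complex.Im z + complex.Im w.
Proof. by case: z; case: w. Qed.

Lemma Re_opp z : complex.Re (- z) = - complex.Re z.
Proof. by case: z. Qed.

Lemma Im_opp z : complex.Im (- z) = - complex.Im z.
Proof. by case: z. Qed.

Lemma Re_mul z w : complex.Re (z * w) =
  complex.Re z * complex.Re w - complex.Im z * complex.Im w.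
Proof. by case: z; case: w. Qed.

Lemma Im_mul z w : complex.Im (z * w) =
  complex.Re z * complex.Im w + complex.Im z * complex.Re w.
Proof. by case: z => a b; case: w => c d /=; rewrite [b * c]mulrC. Qed.

Lemma complex_ext z w :
  complex.Re z = complex.Re w -> complex.Im z = complex.Im w -> z = w.
Proof. by case: z => a b; case: w => c d /= -> ->. Qed.

End ComplexBasics.

(** The division-free form is what Goursat's argument consumes: an affine approximation whose error
    is small relative to |h|. Both tolerances are real, and h = 0 needs no exclusion. *)
Definition has_cderiv (R : realType) (f : R[i] -> R[i]) (z L : R[i]) :=
  forall e : R, 0 < e -> exists2 d : R, 0 < d & forall h, cmod h < d ->
    cmod (f (z + h) - f z - L * h) <= e * cmod h.

Section ComplexDerivative.
Variable R : realType.
Implicit Types (f g : R[i] -> R[i]) (z w L h : R[i]).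

Lemma derivable_has_cderiv f z :
  derivable (f : R[i]^o -> R[i]^o) z 1 -> exists L, has_cderiv f z L.
Proof.
move=> /cvg_ex[L fL]; exists L => e e0.
have eC : (0 : R[i]) < e%:C by rewrite ltcR.
move/cvgrPdist_le : fL => /(_ _ eC)[/= d d0 H].
(* In the order of [R[i]], 0 < d says that d is real and positive, so its real part is a usable
   radius. *)
have [dI dR] : complex.Im d = 0 /\ 0 < complex.Re d.
  by move: (d0); rewrite /= ltcE /= => /andP[/eqP-> ->].
exists (complex.Re d) => // h hd.
have [->|h0] := eqVneq h 0.
  by rewrite addr0 subrr sub0r mulr0 oppr0 cmod0 mulr0.
have := H h.
rewrite /ball_/= sub0r normrN cmod_norm ltcE /= dI eqxx => /(_ hd h0).
rewrite cmod_norm lecR => le_e.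
have -> : f (z + h) - f z - L * h =
  - h * (L - h^-1 * (f (h * 1 + z) - f z)).
  rewrite mulr1 (addrC h); field; exact: h0.
by rewrite cmodM cmodN mulrC ler_wpM2r ?cmod_ge0.
Qed.

Lemma has_cderiv_derive1 f z L :
  has_cderiv f z L -> derive1 (f : R[i] -> R[i]^o) z = L.
Proof.
move=> fL; apply/cvg_lim => //; apply/cvgrPdist_le => e e0.
have [eI eR] : complex.Im e = 0 /\ 0 < complex.Re e.
  by move: (e0); rewrite ltcE /= => /andP[/eqP-> ->].
have [d d0 H] := fL _ eR.
exists d%:C; first by rewrite /= ltcR.
move=> h /=; rewrite sub0r normrN cmod_norm ltcR => hd h0.
have -> : e = (complex.Re e)%:C by rewrite [LHS]complexE eI mulr0 addr0.
rewrite cmod_norm lecR.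
have -> : L - h^-1 *: (f (h + z) - f z) =
   - (f (z + h) - f z - L * h) / h.
  rewrite (addrC h) /GRing.scale /=; field; exact: h0.
rewrite cmodM cmodN cmodV ler_pdivrMr ?cmod_gt0//; exact: H.
Qed.

Lemma has_cderiv_local f g z L : has_cderiv g z L ->
  (exists2 d : R, 0 < d & forall w, cmod (w - z) < d -> f w = g w) ->
  has_cderiv f z L.
Proof.
move=> gL [d d0 fg] e /gL[d' d'0 H]; exists (Num.min d d').
  by rewrite lt_min d0.
move=> h; rewrite lt_min => /andP[h1 h2].
by rewrite !fg ?subrr ?cmod0 ?H// addrC addKr.
Qed.

Lemma has_cderiv_lip f z L : has_cderiv f z L -> exists2 K : R, 0 < K &
  exists2 d : R, 0 < d & forall h, cmod h < d -> cmod (f (z + h) - f z) <= K * cmod h.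
Proof.
move=> /(_ 1 ltr01)[d d0 H]; exists (1 + cmod L).
  by rewrite ltr_pwDl ?cmod_ge0.
exists d => // h /H le1.
rewrite -[X in cmod X](subrK (L * h)) mulrDl -cmodM.
exact: le_trans (cmodD _ _) (lerD le1 (lexx _)).
Qed.

Lemma has_cderiv_cont f z L : has_cderiv f z L -> forall e : R, 0 < e ->
  exists2 d : R, 0 < d & forall w, cmod (w - z) < d -> cmod (f w - f z) < e.
Proof.
move=> /has_cderiv_lip[K K0 [d d0 H]] e e0.
exists (Num.min d (e / K)); first by rewrite lt_min d0 divr_gt0.
move=> w; rewrite lt_min => /andP[w1 w2].
rewrite -[w in f w](subrK z) addrC (addrC _ z).
have := H _ w1; rewrite addrC => /le_lt_trans; apply.
by rewrite mulrC -ltr_pdivlMr.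
Qed.

Lemma has_cderivM f g z L M : has_cderiv f z L -> has_cderiv g z M ->
  has_cderiv (fun w => f w * g w) z (L * g z + f z * M).
Proof.
move=> fL gM e e0.
have [K K0 [d1 d10 lipf]] := has_cderiv_lip fL.
have [K' K'0 [d2 d20 lipg]] := has_cderiv_lip gM.
(* The error splits into three terms, each allowed e / 3. The constant [B] absorbs the factors |f z|
   and |g z| of the first two, and [d5] below controls the product of the two increments. *)
pose B := 3 * (cmod (g z) + cmod (f z) + 1).
have B0 : 0 < B by rewrite mulr_gt0// ltr_wpDl// addr_ge0// cmod_ge0.
have eB : 0 < e / B by rewrite divr_gt0.
have [d3 d30 H3] := fL _ eB.
have [d4 d40 H4] := gM _ eB.
pose d5 := e / (3 * K * K').
have d50 : 0 < d5 by rewrite divr_gt0// !mulr_gt0.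
exists (Num.min (Num.min d1 d2) (Num.min (Num.min d3 d4) d5)).
  by rewrite !lt_min d10 d20 d30 d40 d50.
move=> h; rewrite !lt_min => /andP[/andP[h1 h2] /andP[/andP[h3 h4] h5]].
have -> : f (z + h) * g (z + h) - f z * g z - (L * g z + f z * M) * h =
  (f (z + h) - f z - L * h) * g z + f z * (g (z + h) - g z - M * h) +
  (f (z + h) - f z) * (g (z + h) - g z) by ring.
have H0 := cmod_ge0 h.
have t1 := H3 _ h3; have t2 := H4 _ h4; have t3 := lipf _ h1.
have t4 := lipg _ h2.
have third : forall a : R, 0 <= a -> a <= B / 3 -> (e / B * cmod h) * a <= e / 3 * cmod h.
  move=> a a0 aB; have -> : e / 3 * cmod h = (e / B * cmod h) * (B / 3).
    by field; rewrite gt_eqF.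
  by rewrite ler_wpM2l// mulr_ge0// ltW.
have B3 : B / 3 = cmod (g z) + cmod (f z) + 1 by rewrite /B; field.
apply: (le_trans (cmodD _ _)).
have -> : e * cmod h = e / 3 * cmod h + e / 3 * cmod h + e / 3 * cmod h by field.
apply: lerD; first (apply: (le_trans (cmodD _ _)); apply: lerD).
- rewrite cmodM; apply: le_trans (third _ (cmod_ge0 (g z)) _).
    by rewrite ler_wpM2r ?cmod_ge0.
  by rewrite B3 -addrA lerDl addr_ge0// cmod_ge0.
- rewrite cmodM mulrC; apply: le_trans (third _ (cmod_ge0 (f z)) _).
    by rewrite ler_wpM2r ?cmod_ge0.
  by rewrite B3 (addrC (cmod (g z))) -addrA lerDl addr_ge0// cmod_ge0.
- rewrite cmodM; apply: (@le_trans _ _ ((K * cmod h) * (K' * cmod h))).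
    by apply: ler_pM; rewrite ?cmod_ge0.
  have -> : K * cmod h * (K' * cmod h) = (cmod h * (K * K')) * cmod h by ring.
  rewrite ler_wpM2r// -ler_pdivlMr ?mulr_gt0//.
  apply: le_trans (ltW h5) _; rewrite /d5 le_eqVlt; apply/orP; left; apply/eqP.
  by field; rewrite !gt_eqF.
Qed.

Lemma has_cderiv_inv z a : z != a ->
  has_cderiv (fun w => (w - a)^-1) z (- (z - a)^-1 ^+ 2).
Proof.
move=> za e e0; set u := z - a.
have u0 : u != 0 by rewrite subr_eq0.
have cu0 : 0 < cmod u by rewrite cmod_gt0.
(* The first bound keeps |u + h| >= |u| / 2. The error is then at most 2 |h|^2 / |u|^3, which
   explains the second. *)
pose d := Num.min (cmod u / 2) (e * cmod u ^+ 3 / 2).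
exists d; first by rewrite lt_min !divr_gt0// mulr_gt0// exprn_gt0.
move=> h; rewrite lt_min => /andP[h1 h2].
rewrite (_ : z + h - a = u + h); last by rewrite /u addrAC.
have cuh : cmod u / 2 <= cmod (u + h).
  have := cmodB (u + h) h; rewrite addrK; lra.
have uh0 : u + h != 0 by rewrite -cmod_gt0; lra.
have -> : (u + h)^-1 - u^-1 - (- u^-1 ^+ 2) * h = h * (h * (u^-1 ^+ 2 / (u + h))).
  by field; rewrite u0 uh0.
rewrite cmodM mulrC ler_wpM2r ?cmod_ge0// cmodM cmodM cmodX !cmodV.
have : (cmod (u + h))^-1 <= 2 / cmod u.
  rewrite -[leRHS]invrK lef_pV2 ?posrE ?invr_gt0 ?divr_gt0//; last by lra.
  by rewrite invf_div.
move=> le2.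
apply: (@le_trans _ _ (cmod h * ((cmod u)^-1 ^+ 2 * (2 / cmod u)))).
  by rewrite ler_wpM2l ?cmod_ge0// ler_wpM2l// exprn_ge0// invr_ge0 cmod_ge0.
rewrite (_ : _ * _ = cmod h / (cmod u ^+ 3 / 2)); last by field; rewrite gt_eqF.
rewrite ler_pdivrMr ?divr_gt0 ?exprn_gt0//; rewrite mulrA; exact: ltW.
Qed.

End ComplexDerivative.

(** * Paths and their integrals *)

Section Paths.
Variable R : realType.
Notation mu := (@lebesgue_measure R).
Implicit Types (g u v : R -> R[i]) (a b t : R) (z w : R[i]).

(* Continuity and derivatives of a path are read off its two real coordinates,
   where the real integration theory applies. *)
Definition ccont g :=
  continuous (fun t => complex.Re (g t)) /\ continuous (fun t => complex.Im (g t)).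

Definition cdiff g t (d : R[i]) :=
  is_derive t 1 (fun t => complex.Re (g t)) (complex.Re d) /\
  is_derive t 1 (fun t => complex.Im (g t)) (complex.Im d).

Definition cint a b g : R[i] :=
  (\int[mu]_(t in `[a, b]) complex.Re (g t)) +i*
  (\int[mu]_(t in `[a, b]) complex.Im (g t)).

Lemma ccontP g : ccont g <-> forall t (e : R), 0 < e -> exists2 d : R, 0 < d &
  forall s, `|s - t| < d -> cmod (g s - g t) < e.
Proof.
split=> [[cR cI] t e e0|H].
  have e2 : 0 < e / 2 by rewrite divr_gt0.
  have /cvgrPdist_lt/(_ _ e2)[d1 /= d10 H1] := cR t.
  have /cvgrPdist_lt/(_ _ e2)[d2 /= d20 H2] := cI t.
  exists (Num.min d1 d2); first by rewrite lt_min d10.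
  move=> s; rewrite lt_min => /andP[s1 s2].
  rewrite (le_lt_trans (cmod_le_ReIm _))// Re_add Im_add Re_opp Im_opp.
  rewrite [e]splitr ltrD// distrC; [apply: H1|apply: H2]; by rewrite /= distrC.
split=> t; apply/cvgrPdist_lt => e e0; have [d d0 Hd] := H t e e0;
  exists d => // s /=; rewrite distrC => /Hd; apply: le_lt_trans; rewrite distrC.
  by rewrite -Re_opp -Re_add Re_le_cmod.
by rewrite -Im_opp -Im_add Im_le_cmod.
Qed.

Lemma eq_ccont u v : u =1 v -> ccont u -> ccont v.
Proof. by move=> /funext ->. Qed.

Lemma ccont_cst z : ccont (fun=> z).
Proof. by split; exact: cst_continuous. Qed.

Lemma ccontD u v : ccont u -> ccont v -> ccont (fun t => u t + v t).
Proof.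
move=> [u1 u2] [v1 v2]; split.
  under eq_fun do rewrite Re_add.
  by move=> t; apply: continuousD; [exact: u1|exact: v1].
under eq_fun do rewrite Im_add.
by move=> t; apply: continuousD; [exact: u2|exact: v2].
Qed.

Lemma ccontM u v : ccont u -> ccont v -> ccont (fun t => u t * v t).
Proof.
move=> [u1 u2] [v1 v2]; split.
  under eq_fun do rewrite Re_mul.
  move=> t; apply: (@continuousB _ R^o R (fun t => _ * _) (fun t => _ * _)); apply: (@continuousM R R).
  - exact: u1.
  - exact: v1.
  - exact: u2.
  - exact: v2.
under eq_fun do rewrite Im_mul.
move=> t; apply: (@continuousD _ R^o R (fun t => _ * _) (fun t => _ * _)); apply: (@continuousM R R).
- exact: u1.
- exact: v2.
- exact: u2.
- exact: v1.
Qed.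

Lemma ccontZ z v : ccont v -> ccont (fun t => z * v t).
Proof. by apply: ccontM; exact: ccont_cst. Qed.

Lemma ccontN v : ccont v -> ccont (fun t => - v t).
Proof. by move=> /(ccontZ (-1)); apply: eq_ccont => t; rewrite mulN1r. Qed.

Lemma ccontB u v : ccont u -> ccont v -> ccont (fun t => u t - v t).
Proof. by move=> cu /ccontN; exact: ccontD. Qed.

Lemma ccontX u n : ccont u -> ccont (fun t => u t ^+ n).
Proof.
move=> cu; elim: n => [|n IH]; first exact: ccont_cst.
by apply: eq_ccont (ccontM cu IH) => t; rewrite exprS.
Qed.

Lemma ccont_conj u : ccont u -> ccont (fun t => (u t)^*).
Proof.
move=> [u1 u2]; split.
  by rewrite (_ : (fun _ => _) = (fun t => complex.Re (u t)))//; apply/funext => t; case: (u t).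
rewrite (_ : (fun _ => _) = (fun t => - complex.Im (u t))); last by apply/funext => t; case: (u t).
by move=> t; apply: continuousN; exact: u2.
Qed.

Lemma ccont_sum (I : Type) (r : seq I) (P : pred I) (F : I -> R -> R[i]) :
  (forall i, ccont (F i)) -> ccont (fun t => \sum_(i <- r | P i) F i t).
Proof.
move=> cF; elim: r => [|i r IH].
  by under eq_fun do rewrite big_nil; exact: ccont_cst.
under eq_fun do rewrite big_cons.
by case: (P i) => //; exact: ccontD.
Qed.

Lemma ccont_comp (f : R[i] -> R[i]) u : ccont u ->
  (forall t, exists L, has_cderiv f (u t) L) -> ccont (fun t => f (u t)).
Proof.
move=> /ccontP cu fd; apply/ccontP => t e e0.
have [L /has_cderiv_cont/(_ _ e0)[d d0 Hd]] := fd t.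
by have [d' d'0 Hd'] := cu t _ d0; exists d' => // s /Hd'/Hd.
Qed.

Lemma ccont_inv u : ccont u -> (forall t, u t != 0) -> ccont (fun t => (u t)^-1).
Proof.
move=> cu u0; apply: (ccont_comp (f := fun w => w^-1)) => // t.
exists (- (u t - 0)^-1 ^+ 2); apply: has_cderiv_local (has_cderiv_inv (u0 t)) _.
by exists 1 => // w _; rewrite subr0.
Qed.

Lemma ccont_cmod2 u : ccont u -> continuous (fun t => cmod (u t) ^+ 2).
Proof.
move=> [u1 u2]; under eq_fun do rewrite cmod_sqr !expr2.
move=> t; apply: (@continuousD _ R^o R (fun t => _ * _) (fun t => _ * _)); apply: (@continuousM R R).
- exact: u1.
- exact: u1.
- exact: u2.
- exact: u2.
Qed.

Lemma cdiff_ccont u u' : (forall t, cdiff u t (u' t)) -> ccont u.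
Proof.
move=> du; split=> t; apply: differentiable_continuous; apply/derivable1_diffP;
  by have [? ?] := du t; exact: ex_derive.
Qed.

Lemma cdiff_cst z t : cdiff (fun=> z) t 0.
Proof. by split; exact: is_derive_cst. Qed.

Lemma cdiffD u v t (u' v' : R[i]) : cdiff u t u' -> cdiff v t v' ->
  cdiff (fun t => u t + v t) t (u' + v').
Proof.
move=> [u1 u2] [v1 v2]; split.
  by under eq_fun do rewrite Re_add; rewrite Re_add; exact: is_deriveD.
by under eq_fun do rewrite Im_add; rewrite Im_add; exact: is_deriveD.
Qed.

Lemma cdiffM u v t (u' v' : R[i]) : cdiff u t u' -> cdiff v t v' ->
  cdiff (fun t => u t * v t) t (u' * v t + u t * v').
Proof.
move=> [u1 u2] [v1 v2]; split.
  under eq_fun do rewrite Re_mul.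
  apply: (is_derive_eq (is_deriveB (is_deriveM u1 v1) (is_deriveM u2 v2))).
  rewrite Re_add !Re_mul /GRing.scale /=; ring.
under eq_fun do rewrite Im_mul.
apply: (is_derive_eq (is_deriveD (is_deriveM u1 v2) (is_deriveM u2 v1))).
rewrite Im_add !Im_mul /GRing.scale /=; ring.
Qed.

Lemma cdiffZ z v t (v' : R[i]) : cdiff v t v' -> cdiff (fun t => z * v t) t (z * v').
Proof.
by move=> dv; have := cdiffM (cdiff_cst z t) dv; rewrite mul0r add0r.
Qed.

Lemma cdiffX u n t (u' : R[i]) : cdiff u t u' ->
  cdiff (fun t => u t ^+ n) t (n%:R * u t ^+ n.-1 * u').
Proof.
move=> du; elim: n => [|n IH]; first by rewrite !mul0r; exact: cdiff_cst.
rewrite (_ : (fun _ => _) = (fun t => u t * u t ^+ n)); last first.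
  by apply/funext => s; rewrite exprS.
have := cdiffM du IH; congr cdiff; rewrite /= -natr1.
case: n {IH} => [|n]; first by rewrite !mul0r mulr0 !expr0; ring.
by rewrite /= exprS; ring.
Qed.

Lemma cdiff_real (r : R -> R) t r' : is_derive t 1 r r' ->
  cdiff (fun t => (r t)%:C) t r'%:C.
Proof. by move=> dr; split => //=; exact: is_derive_cst. Qed.

Lemma continuous_integrable (h : R -> R) a b : continuous h ->
  mu.-integrable `[a, b] (EFin \o h).
Proof.
move=> ch; apply: continuous_compact_integrable; first exact: segment_compact.
exact: continuous_subspaceT.
Qed.

Lemma cintD a b u v : ccont u -> ccont v ->
  cint a b (fun t => u t + v t) = cint a b u + cint a b v.
Proof.
move=> [u1 u2] [v1 v2]; apply: complex_ext; rewrite ?Re_add ?Im_add /=.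
  by under eq_Rintegral do rewrite Re_add; rewrite RintegralD//; exact: continuous_integrable.
by under eq_Rintegral do rewrite Im_add; rewrite RintegralD//; exact: continuous_integrable.
Qed.

Lemma cintZ a b z v : ccont v -> cint a b (fun t => z * v t) = z * cint a b v.
Proof.
move=> [v1 v2]; have cZ (r : R) (h : R -> R) : continuous h -> continuous (fun t => r * h t).
  by move=> ch t; apply: (@continuousM R R); [exact: cst_continuous|exact: ch].
apply: complex_ext; rewrite ?Re_mul ?Im_mul /=.
  under eq_Rintegral do rewrite Re_mul.
  by rewrite RintegralB ?RintegralZl//; apply: continuous_integrable => //; exact: cZ.
under eq_Rintegral do rewrite Im_mul.
by rewrite RintegralD ?RintegralZl//; apply: continuous_integrable => //; exact: cZ.
Qed.

Lemma cintB a b u v : ccont u -> ccont v ->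
  cint a b (fun t => u t - v t) = cint a b u - cint a b v.
Proof.
move=> cu cv; rewrite -[- cint a b v]mulN1r -cintZ//.
under [X in cint a b X]eq_fun do rewrite -mulN1r.
by rewrite cintD//; exact: ccontZ.
Qed.

Lemma cint_sum a b (I : Type) (r : seq I) (P : pred I) (F : I -> R -> R[i]) :
  (forall i, ccont (F i)) ->
  cint a b (fun t => \sum_(i <- r | P i) F i t) = \sum_(i <- r | P i) cint a b (F i).
Proof.
move=> cF; elim: r => [|i r IH].
  under [X in cint a b X]eq_fun do rewrite big_nil.
  by rewrite big_nil; have := cintZ a b 0 (ccont_cst 0); rewrite !mul0r.
under [X in cint a b X]eq_fun do rewrite big_cons.
rewrite big_cons; case: (P i) => //; rewrite cintD ?IH//; exact: ccont_sum.
Qed.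

Lemma cint_chasles a b c g : a <= b -> b <= c -> ccont g ->
  cint a c g = cint a b g + cint b c g.
Proof.
have key (h : R -> R) : a <= b -> b <= c -> continuous h ->
    \int[mu]_(t in `[a, c]) h t = \int[mu]_(t in `[a, b]) h t + \int[mu]_(t in `[b, c]) h t.
  move=> ab bc ch; rewrite -[X in _ + X]Rintegral_itv_obnd_cbnd; last first.
    apply: (integrableS _ _ _ (continuous_integrable b c ch)) => //.
    by move=> t /=; rewrite !in_itv/= => /andP[/ltW-> ->].
  rewrite -(Rintegral_itvB (a := BLeft a) (b := BRight c)) ?bnd_simp//; last exact: continuous_integrable.
  by rewrite addrC subrK.
by move=> ab bc [c1 c2]; apply: complex_ext; rewrite ?Re_add ?Im_add /=; exact: key.
Qed.

Lemma cint_FTC a b G g : a <= b -> (forall t, cdiff G t (g t)) -> ccont g ->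
  cint a b g = G b - G a.
Proof.
have key (H h : R -> R) : a <= b -> (forall t, is_derive t 1 H (h t)) -> continuous h ->
    \int[mu]_(t in `[a, b]) h t = H b - H a.
  rewrite le_eqVlt => /predU1P[-> _ _|ab dH ch].
    by rewrite set_itv1 Rintegral_set1 subrr.
  have cH : continuous H.
    move=> t; apply: differentiable_continuous; apply/derivable1_diffP.
    exact: ex_derive.
  rewrite /Rintegral (continuous_FTC2 (F := H)) //.
  - exact: continuous_subspaceT.
  - split=> [x _| |]; first exact: ex_derive.
      apply: cvg_at_right_filter; exact: cH.
    apply: cvg_at_left_filter; exact: cH.
  - by move=> x _; rewrite derive1E; exact: derive_val.
move=> ab dG [g1 g2]; apply: complex_ext; rewrite ?Re_add ?Im_add ?Re_opp ?Im_opp/=.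
  by apply: (key (fun t => complex.Re (G t))) => // t; case: (dG t).
by apply: (key (fun t => complex.Im (G t))) => // t; case: (dG t).
Qed.

(** The factor 2 comes from estimating the two coordinates separately; every use tolerates a
    constant factor. *)
Lemma cint_bound a b g (M : R) : a <= b -> ccont g ->
  (forall t, a <= t <= b -> cmod (g t) <= M) -> cmod (cint a b g) <= 2 * M * (b - a).
Proof.
move=> ab [g1 g2] gM.
have key (h : R -> R) : continuous h -> (forall t, a <= t <= b -> `|h t| <= M) ->
    `|\int[mu]_(t in `[a, b]) h t| <= M * (b - a).
  move=> ch hM; have ih := continuous_integrable a b ch.
  apply: le_trans (le_normr_Rintegral _ ih) _ => //.
  apply: (@le_trans _ _ (\int[mu]_(t in `[a, b]) M)); last first.
    rewrite Rintegral_cst//= lebesgue_measure_itv/= lte_fin.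
    by case: ltP => //= ba; rewrite (le_anti (_ : a <= b <= a)) ?ab ?ba// subrr.
  apply: le_Rintegral => //.
  - apply: continuous_integrable => t.
    by apply: continuous_comp; [exact: ch|exact: norm_continuous].
  - by apply: continuous_integrable; exact: cst_continuous.
apply: le_trans (cmod_le_ReIm _) _.
rewrite -mulrA mulr2n mulrDl mul1r lerD// /=; apply: key => // t /gM; apply: le_trans.
  exact: Re_le_cmod.
exact: Im_le_cmod.
Qed.

Lemma eq_cint a b u v : (forall t, u t = v t) -> cint a b u = cint a b v.
Proof. by move=> /funext ->. Qed.

End Paths.

(** * Goursat's theorem *)

Section Goursat.
Variable R : realType.

Lemma halving_small (l d : R) : 0 < l -> 0 < d -> exists k : nat, l / 2 ^+ k < d.
Proof.
move=> l0 d0; exists (Num.bound (l / d)).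
rewrite ltr_pdivrMr ?exprn_gt0// mulrC -ltr_pdivrMr//.
apply: lt_trans (archi_boundP _) _; first by rewrite divr_ge0// ltW.
by rewrite -natrX ltr_nat ltn_expl.
Qed.

Lemma nested_point (a : nat -> R) (l : nat -> R) :
  (forall k, a k <= a k.+1) -> (forall k, a k.+1 + l k.+1 <= a k + l k) ->
  (forall k, 0 <= l k) -> exists p, forall k, a k <= p <= a k + l k.
Proof.
move=> aS bS l0.
have amono k j : (k <= j)%N -> a k <= a j.
  by move/subnK=> <-; elim: (j - k)%N => // m IH; rewrite (le_trans IH).
have bmono k j : (k <= j)%N -> a j + l j <= a k + l k.
  by move/subnK=> <-; elim: (j - k)%N => // m IH; rewrite (le_trans (bS _)).
have ub k : ubound (range a) (a k + l k).
  move=> _ [j _ <-]; have [kj|/ltnW jk] := leqP k j.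
    by rewrite (le_trans _ (bmono _ _ kj))// lerDl.
  by rewrite (le_trans (amono _ _ jk))// lerDl.
have ne : range a !=set0 by exists (a 0%N), 0%N.
exists (sup (range a)) => k; apply/andP; split.
  by apply: ub_le_sup; [exists (a 0%N + l 0%N)|exists k].
by apply: ge_sup.
Qed.

(** If P failed on a rectangle it would fail on one of its quarters, and so on along nested
    rectangles shrinking to a point (p, q), near which [small] forbids failure. The shape (A, B) is
    fixed, so a single scale l describes each rectangle, and degenerate sides are allowed. *)
Lemma rectangle_bisection (P : R -> R -> R -> Prop) (A B : R) : 0 <= A -> 0 <= B ->
  (forall a c l, 0 < l -> P a c (l / 2) -> P (a + l / 2 * A) c (l / 2) ->
     P a (c + l / 2 * B) (l / 2) -> P (a + l / 2 * A) (c + l / 2 * B) (l / 2) ->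
     P a c l) ->
  (forall p q, exists2 d : R, 0 < d & forall a c l, 0 < l -> l < d ->
     a <= p <= a + l * A -> c <= q <= c + l * B -> P a c l) ->
  forall a c l, 0 < l -> P a c l.
Proof.
move=> A0 B0 quarters small a0 c0 l0 l0_gt0; apply: contrapT => nP.
(* [choice] needs a successor for every triple; one with nonpositive scale is sent to itself, where
   the claim is vacuous. *)
have next (x : R * R * R) : exists y : R * R * R, 0 < x.2 -> ~ P x.1.1 x.1.2 x.2 ->
    [/\ ~ P y.1.1 y.1.2 y.2, y.2 = x.2 / 2,
      x.1.1 <= y.1.1 /\ y.1.1 + y.2 * A <= x.1.1 + x.2 * A &
      x.1.2 <= y.1.2 /\ y.1.2 + y.2 * B <= x.1.2 + x.2 * B].
  case: x => -[a c] l /=; have [l_gt0|] := ltP 0 l; last by exists (a, c, l).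
  have lA : 0 <= l / 2 * A by rewrite mulr_ge0// divr_ge0// ltW.
  have lB : 0 <= l / 2 * B by rewrite mulr_ge0// divr_ge0// ltW.
  have [P1|nP1] := pselect (P a c (l / 2)); last first.
    by exists (a, c, l / 2) => _ _; split => //=; split => //; lra.
  have [P2|nP2] := pselect (P (a + l / 2 * A) c (l / 2)); last first.
    by exists (a + l / 2 * A, c, l / 2) => _ _; split => //=; split => //; lra.
  have [P3|nP3] := pselect (P a (c + l / 2 * B) (l / 2)); last first.
    by exists (a, c + l / 2 * B, l / 2) => _ _; split => //=; split => //; lra.
  have [P4|nP4] := pselect (P (a + l / 2 * A) (c + l / 2 * B) (l / 2)); last first.
    by exists (a + l / 2 * A, c + l / 2 * B, l / 2) => _ _; split => //=; split => //; lra.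
  by exists (a, c, l) => _ [] //; exact: quarters.
have [F FP] := choice next.
pose x k := iter k F (a0, c0, l0).
have xP k : ~ P (x k).1.1 (x k).1.2 (x k).2 /\ (x k).2 = l0 / 2 ^+ k.
  elim: k => [|k [nPk lk]]; first by rewrite expr0 divr1.
  have lk0 : 0 < (x k).2 by rewrite lk divr_gt0// exprn_gt0.
  have [nP' l' _ _] := FP _ lk0 nPk; split; first exact: nP'.
  by rewrite [LHS]l' lk exprS invfM mulrA -!mulrA (mulrC 2^-1).
have l_gt0 k : 0 < (x k).2 by have [_ ->] := xP k; rewrite divr_gt0// exprn_gt0.
have [p pP] : exists p, forall k, (x k).1.1 <= p <= (x k).1.1 + (x k).2 * A.
  apply: nested_point => k; try (by rewrite mulr_ge0// ltW);
    by have [nPk _] := xP k; have [_ _ [? ?] _] := FP _ (l_gt0 k) nPk.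
have [q qP] : exists q, forall k, (x k).1.2 <= q <= (x k).1.2 + (x k).2 * B.
  apply: nested_point => k; try (by rewrite mulr_ge0// ltW);
    by have [nPk _] := xP k; have [_ _ _ [? ?]] := FP _ (l_gt0 k) nPk.
have [d d0 dP] := small p q.
have [k kd] := halving_small l0_gt0 d0.
have [nPk lk] := xP k; apply: nPk; apply: dP => //; by rewrite lk.
Qed.

Lemma path_lip (g g' : R -> R[i]) (L : R) : (forall t, cdiff g t (g' t)) -> ccont g' ->
  (forall t, cmod (g' t) <= L) -> forall s t, cmod (g t - g s) <= 2 * L * `|t - s|.
Proof.
move=> dg cg gL s t; wlog st : s t / s <= t => [H|].
  by case: (leP s t) => [/H//|/ltW/H]; rewrite cmodBC distrC.
by rewrite -(cint_FTC st dg cg) (ger0_norm (_ : 0 <= t - s)) ?subr_ge0//; apply: cint_bound.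
Qed.

(** An affine function has a primitive, so its integral depends only on the endpoints. Around a
    closed boundary these terms cancel and only the deviation of [f] from its affine approximation
    remains. *)
Lemma path_affine_part (f : R[i] -> R[i]) (g g' : R -> R[i]) (al be : R[i]) a b :
  a <= b -> (forall t, cdiff g t (g' t)) -> ccont g' -> ccont (fun t => f (g t)) ->
  cint a b (fun t => f (g t) * g' t) =
  (al * g b + be / 2 * g b ^+ 2) - (al * g a + be / 2 * g a ^+ 2) +
  cint a b (fun t => (f (g t) - (al + be * g t)) * g' t).
Proof.
move=> ab dg cg cf; have cg0 := cdiff_ccont dg.
have caff : ccont (fun t => al + be * g t).
  by apply: ccontD; [exact: ccont_cst|exact: ccontZ].
rewrite -(@cint_FTC _ a b (fun t => al * g t + be / 2 * g t ^+ 2)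
  (fun t => (al + be * g t) * g' t))//; last 2 first.
- move=> t; have := cdiffD (cdiffZ al (dg t)) (cdiffZ (be / 2) (cdiffX 2 (dg t))).
  by congr cdiff; rewrite /= expr1; field.
- by apply: ccontM.
rewrite -cintD; [|by apply: ccontM|by apply: ccontM => //; apply: ccontB].
by apply: eq_cint => t; ring.
Qed.

Variables (f : R[i] -> R[i]) (Phi Phis Phit : R -> R -> R[i]) (L : R).
Hypothesis L0 : 0 <= L.
Hypothesis dPhis : forall s t, cdiff (Phi^~ t) s (Phis s t).
Hypothesis dPhit : forall s t, cdiff (Phi s) t (Phit s t).
Hypothesis cPhis : forall t, ccont (Phis^~ t).
Hypothesis cPhit : forall s, ccont (Phit s).
Hypothesis Phis_le : forall s t, cmod (Phis s t) <= L.
Hypothesis Phit_le : forall s t, cmod (Phit s t) <= L.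
Hypothesis f_holo : forall s t, exists D, has_cderiv f (Phi s t) D.

Let Es a b t := cint a b (fun s => f (Phi s t) * Phis s t).
Let Et c d s := cint c d (fun t => f (Phi s t) * Phit s t).
Let boundary a b c d := Es a b c + Et c d b - Es a b d - Et c d a.

Let cfs t : ccont (fun s => f (Phi s t)).
Proof. by apply: ccont_comp => //; exact: (cdiff_ccont (dPhis^~ t)). Qed.

Let cft s : ccont (fun t => f (Phi s t)).
Proof. by apply: ccont_comp => //; exact: (cdiff_ccont (dPhit s)). Qed.

Let Phi_lip s t s' t' : cmod (Phi s' t' - Phi s t) <= 2 * L * (`|s' - s| + `|t' - t|).
Proof.
have -> : Phi s' t' - Phi s t = (Phi s' t' - Phi s t') + (Phi s t' - Phi s t) by ring.
apply: le_trans (cmodD _ _) _; rewrite mulrDr.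
apply: lerD; first exact: (path_lip (dPhis^~ t') (cPhis t') (Phis_le^~ t')).
exact: (path_lip (dPhit s) (cPhit s) (Phit_le s)).
Qed.

(** The inner edges are traversed twice, in opposite directions. *)
Let boundary_quarters a b c d a' c' : a <= a' -> a' <= b -> c <= c' -> c' <= d ->
  boundary a b c d = boundary a a' c c' + boundary a' b c c' +
                     boundary a a' c' d + boundary a' b c' d.
Proof.
move=> aa' a'b cc' c'd; rewrite /boundary /Es /Et.
rewrite !(cint_chasles aa' a'b) ?(cint_chasles cc' c'd); [ring|exact: ccontM..].
Qed.

Let boundary_small (A B e : R) : 0 <= A -> 0 <= B -> 0 < e -> forall p q,
  exists2 d : R, 0 < d & forall a c l, 0 < l -> l < d ->
     a <= p <= a + l * A -> c <= q <= c + l * B ->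
     cmod (boundary a (a + l * A) c (c + l * B)) <= e * l ^+ 2.
Proof.
move=> A0 B0 e0 p q; have [D fD] := f_holo p q.
(* On each edge the deviation is O(l) and the length is O(l); the four edges together give 8 L^2 (A
   + B)^2 l^2 e / K, hence the choice of [K]. The constant [M] below makes the image of the
   rectangle stay within d of [Phi p q]. Both end in + 1 to remain positive when L or A + B is 0. *)
pose K := 16 * L ^+ 2 * (A + B) ^+ 2 + 1.
have K0 : 0 < K by rewrite ltr_wpDl// mulr_ge0 ?sqr_ge0// mulr_ge0 ?sqr_ge0.
have eK : 0 < e / K by rewrite divr_gt0.
have [d d0 Hd] := fD _ eK.
pose M := 2 * L * (A + B) + 1.
have M0 : 0 < M by rewrite ltr_wpDl// mulr_ge0 ?addr_ge0// mulr_ge0.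
exists (d / M); first by rewrite divr_gt0.
move=> a c l l0 ld apa cqc.
have lA0 : 0 <= l * A by rewrite mulr_ge0// ltW.
have lB0 : 0 <= l * B by rewrite mulr_ge0// ltW.
pose al := f (Phi p q) - D * Phi p q.
pose N := e / K * (2 * L * (l * (A + B))).
have N0 : 0 <= N by rewrite mulr_ge0 ?(ltW eK)// !mulr_ge0 ?addr_ge0// ltW.
have close s t : a <= s <= a + l * A -> c <= t <= c + l * B ->
    cmod (f (Phi s t) - (al + D * Phi s t)) <= N.
  move=> sP tP.
  have st : `|s - p| + `|t - q| <= l * (A + B).
    rewrite mulrDr lerD// ler_norml; apply/andP; split; lra.
  have dist : cmod (Phi s t - Phi p q) <= 2 * L * (l * (A + B)).
    by apply: le_trans (Phi_lip _ _ _ _) _; rewrite ler_wpM2l// mulr_ge0.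
  have := Hd (Phi s t - Phi p q); rewrite (addrC (Phi p q)) subrK => H.
  have -> : f (Phi s t) - (al + D * Phi s t) =
    f (Phi s t) - f (Phi p q) - D * (Phi s t - Phi p q) by rewrite /al; ring.
  apply: le_trans (H _) _; last by rewrite ler_wpM2l// ltW.
  apply: le_lt_trans dist _; rewrite ltr_pdivlMr// in ld.
  have lM : l * M = 2 * L * (l * (A + B)) + l by rewrite /M; ring.
  by apply: le_lt_trans ld; rewrite lM lerDl ltW.
have caff (g : R -> R[i]) : ccont g -> ccont (fun s => al + D * g s).
  by move=> cg; apply: ccontD; [exact: ccont_cst|exact: ccontZ].
have edge_s t : c <= t <= c + l * B ->
    cmod (cint a (a + l * A) (fun s => (f (Phi s t) - (al + D * Phi s t)) * Phis s t))
      <= 2 * (N * L) * (l * A).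
  move=> tP; have -> : 2 * (N * L) * (l * A) = 2 * (N * L) * (a + l * A - a) by ring.
  apply: cint_bound.
  - by rewrite lerDl.
  - apply: ccontM => //; apply: ccontB => //; apply: caff.
    exact: (cdiff_ccont (dPhis^~ t)).
  - by move=> s sP; rewrite cmodM ler_pM ?cmod_ge0//; exact: close.
have edge_t s : a <= s <= a + l * A ->
    cmod (cint c (c + l * B) (fun t => (f (Phi s t) - (al + D * Phi s t)) * Phit s t))
      <= 2 * (N * L) * (l * B).
  move=> sP; have -> : 2 * (N * L) * (l * B) = 2 * (N * L) * (c + l * B - c) by ring.
  apply: cint_bound.
  - by rewrite lerDl.
  - apply: ccontM => //; apply: ccontB => //; apply: caff.
    exact: (cdiff_ccont (dPhit s)).
  - by move=> t tP; rewrite cmodM ler_pM ?cmod_ge0//; exact: close.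
rewrite /boundary /Es /Et.
rewrite !(@path_affine_part f (Phi^~ _) (Phis^~ _) al D a (a + l * A)) ?lerDl//.
rewrite !(@path_affine_part f (Phi _) (Phit _) al D c (c + l * B)) ?lerDl//.
have c1 := edge_s c (ltac:(rewrite lexx lerDl//)).
have c2 := edge_s (c + l * B) (ltac:(rewrite lexx lerDl lB0//)).
have c3 := edge_t a (ltac:(rewrite lexx lerDl//)).
have c4 := edge_t (a + l * A) (ltac:(rewrite lexx lerDl lA0//)).
set I1 := cint a _ _ in c1 *; set I2 := cint a _ _ in c2 *.
set I3 := cint c _ _ in c3 *; set I4 := cint c _ _ in c4 *.
rewrite [X in cmod X](_ : _ = I1 + I4 - I2 - I3); last by ring.
have le4 : cmod (I1 + I4 - I2 - I3) <= cmod I1 + cmod I4 + cmod I2 + cmod I3.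
  apply: le_trans (cmodB _ _) _; rewrite lerD2r.
  apply: le_trans (cmodB _ _) _; rewrite lerD2r; exact: cmodD.
have -> : e * l ^+ 2 = (e / K * l ^+ 2) * K by field; rewrite gt_eqF.
apply: (@le_trans _ _ (e / K * l ^+ 2 * (8 * L ^+ 2 * (A + B) ^+ 2))).
  apply: le_trans le4 _; rewrite (_ : _ * (8 * _ * _) =
    2 * (N * L) * (l * A) + 2 * (N * L) * (l * B) +
    2 * (N * L) * (l * A) + 2 * (N * L) * (l * B)); last by rewrite /N; ring.
  lra.
apply: ler_wpM2l; first by apply: mulr_ge0; [exact: ltW|exact: sqr_ge0].
rewrite /K.
have : 0 <= L ^+ 2 * (A + B) ^+ 2 by rewrite mulr_ge0 ?sqr_ge0.
nra.
Qed.

(* Pulling f(z) dz back by an arbitrary parametrised surface Phi gives the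
   homotopy form of Cauchy's theorem directly. *)
Lemma goursat a b c d : a <= b -> c <= d ->
  cint c d (fun t => f (Phi b t) * Phit b t) - cint c d (fun t => f (Phi a t) * Phit a t) =
  cint a b (fun s => f (Phi s d) * Phis s d) - cint a b (fun s => f (Phi s c) * Phis s c).
Proof.
move=> ab cd; suff b0 : boundary a b c d = 0.
  apply/eqP; rewrite -subr_eq0 -[X in _ == X]b0 /boundary /Es /Et; apply/eqP; ring.
apply/eqP; rewrite -cmod_eq0 eq_le cmod_ge0 andbT; apply/ler_addgt0Pl => e e0.
rewrite addr0.
have A0 : 0 <= b - a by rewrite subr_ge0.
have B0 : 0 <= d - c by rewrite subr_ge0.
(* The tolerance e l^2 is additive under quartering, since 4 (l / 2)^2 = l^2; the given rectangle
   has scale 1. *)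
have := @rectangle_bisection
  (fun a' c' l => cmod (boundary a' (a' + l * (b - a)) c' (c' + l * (d - c))) <= e * l ^+ 2)
  (b - a) (d - c) A0 B0 _ (boundary_small A0 B0 e0) a c 1 ltr01.
rewrite expr1n mulr1 !mul1r !(addrC _ (_ - _)) !subrK; apply.
move=> a' c' l l0 h1 h2 h3 h4.
have lA : 0 <= l / 2 * (b - a) by rewrite mulr_ge0// divr_ge0// ltW.
have lB : 0 <= l / 2 * (d - c) by rewrite mulr_ge0// divr_ge0// ltW.
have eA : a' + l * (b - a) = a' + l / 2 * (b - a) + l / 2 * (b - a) by field.
have eB : c' + l * (d - c) = c' + l / 2 * (d - c) + l / 2 * (d - c) by field.
rewrite (@boundary_quarters _ _ _ _ (a' + l / 2 * (b - a)) (c' + l / 2 * (d - c)));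
  rewrite ?eA ?eB ?lerDl//.
have -> : e * l ^+ 2 = e * (l / 2) ^+ 2 + e * (l / 2) ^+ 2 + e * (l / 2) ^+ 2 + e * (l / 2) ^+ 2.
  by field.
apply: le_trans (cmodD _ _) (lerD _ h4); apply: le_trans (cmodD _ _) (lerD _ h3).
exact: le_trans (cmodD _ _) (lerD h1 h2).
Qed.

End Goursat.

(** * Cauchy's formula on circles *)

Section Circle.
Variable R : realType.

Definition cis (t : R) : R[i] := cos t +i* sin t.

Lemma cdiff_cis t : cdiff cis t ('i * cis t).
Proof.
split; rewrite ?Re_mul ?Im_mul /= ?mul0r ?mul1r ?sub0r ?add0r ?addr0.
  exact: is_derive_cos.
exact: is_derive_sin.
Qed.

Lemma ccont_cis : ccont cis.
Proof. exact: cdiff_ccont cdiff_cis. Qed.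

Lemma cmod_cis t : cmod (cis t) = 1.
Proof.
apply/eqP; rewrite -(@eqrXn2 _ 2) ?cmod_ge0//; apply/eqP.
by rewrite cmod_sqr /= cos2Dsin2 expr1n.
Qed.

Lemma cis_neq0 t : cis t != 0.
Proof. by rewrite -cmod_gt0 cmod_cis. Qed.

Lemma cisJ t : cis t * (cis t)^* = 1.
Proof. by rewrite mulcJ cmod_cis expr1n. Qed.

Lemma cisV t : (cis t)^-1 = (cis t)^*.
Proof. by rewrite -[RHS](mulKf (cis_neq0 t)) cisJ mulr1. Qed.

Lemma cis_period t : cis (t + 2 * pi) = cis t.
Proof.
have -> : 2 * pi = pi *+ 2 :> R by rewrite mulr_natl.
by rewrite /cis cosD2pi sinD2pi.
Qed.

(** The starting angle is left free because the polar coordinates used later run over an interval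
    that starts at - pi / 2. *)
Variable tau : R.

Notation circle_int := (cint tau (tau + 2 * pi)).

Lemma circle_le : tau <= tau + 2 * pi.
Proof. by rewrite lerDl mulr_ge0// pi_ge0. Qed.

Lemma circle_int_cst z : circle_int (fun=> z) = (2 * pi)%:C * z.
Proof.
rewrite (@cint_FTC _ _ _ (fun t => z * t%:C)); last exact: ccont_cst.
- by rewrite -mulrBr -rmorphB /= addrAC subrr add0r mulrC.
- exact: circle_le.
- move=> t; have := cdiffZ z (cdiff_real (is_derive_id t 1)).
  by congr cdiff; rewrite rmorph1 mulr1.
Qed.

Section CauchyFormula.
Variables (f : R[i] -> R[i]) (c z : R[i]) (r : R).
Hypothesis f_holo : forall w, cmod (w - c) <= r -> exists L, has_cderiv f w L.
Hypothesis z_in : cmod (z - c) < r.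

Let r0 : 0 < r. Proof. exact: le_lt_trans (cmod_ge0 _) z_in. Qed.

(* From the circle of radius ep around z (at s = 0) to the circle of radius r
   around c (at s = pi / 2); sin^2 keeps the parameter in [0, 1] for every s, so
   that all hypotheses of goursat hold globally. *)
Let homotopy (ep s t : R) : R[i] :=
  z + ep%:C * cis t + (sin s ^+ 2)%:C * (c - z + (r - ep)%:C * cis t).

Let homotopy_s (ep s t : R) : R[i] :=
  (2 * sin s * cos s)%:C * (c - z + (r - ep)%:C * cis t).

Let homotopy_t (ep s t : R) : R[i] :=
  (ep + sin s ^+ 2 * (r - ep))%:C * ('i * cis t).

Let sin2_le1 (s : R) : 0 <= sin s ^+ 2 <= 1.
Proof. by rewrite sqr_ge0 -(cos2Dsin2 s) lerDr sqr_ge0. Qed.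

(** Goursat's theorem for f w / (w - z) along the homotopy. The edges t = tau and t = tau + 2 pi
    carry the same integral by periodicity, and on the small circle w - z cancels against the
    velocity up to the factor ['i]. *)
Lemma cauchy_shrink (ep : R) : 0 < ep -> ep <= r - cmod (z - c) ->
  circle_int (fun t => f (c + r%:C * cis t) * (r%:C * cis t) / (c + r%:C * cis t - z)) =
  circle_int (fun t => f (z + ep%:C * cis t)).
Proof.
move=> ep0 epr.
have er : 0 <= r - ep by have := cmod_ge0 (z - c); lra.
have phi_in s t : cmod (homotopy ep s t - c) <= r.
  have /andP[s0 s1] := sin2_le1 s.
  (* With u = sin^2 s, the modulus is at most (1 - u) (|z - c| + ep) + u r, a convex combination of
     two numbers that are at most r. *)
  rewrite (_ : _ - c = (1 - sin s ^+ 2)%:C * (z - c) +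
      (ep + sin s ^+ 2 * (r - ep))%:C * cis t); last first.
    by rewrite /homotopy !(rmorphD, rmorphN, rmorphM, rmorph1)/=; ring.
  have rho0 : 0 <= ep + sin s ^+ 2 * (r - ep) by rewrite addr_ge0 ?(ltW ep0)// mulr_ge0.
  apply: le_trans (cmodD _ _) _; rewrite !cmodM !cmod_real cmod_cis mulr1.
  rewrite !ger0_norm ?subr_ge0//; nra.
have phi_z s t : homotopy ep s t != z.
  have /andP[s0 s1] := sin2_le1 s.
  rewrite -subr_eq0 (_ : _ - z = (ep + sin s ^+ 2 * (r - ep))%:C * cis t -
      (sin s ^+ 2)%:C * (z - c)); last first.
    by rewrite /homotopy !(rmorphD, rmorphN, rmorphM, rmorph1)/=; ring.
  (* Meeting z would give (1 - u) ep + u (r - |z - c|) = 0 with u = sin^2 s: two nonnegative terms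
     that cannot both vanish. *)
  apply: contraTneq z_in => /eqP; rewrite subr_eq0 => /eqP/(congr1 (@cmod R)).
  have rho0 : 0 <= ep + sin s ^+ 2 * (r - ep) by rewrite addr_ge0 ?(ltW ep0)// mulr_ge0.
  rewrite !cmodM !cmod_real cmod_cis mulr1 !ger0_norm// => E.
  rewrite -leNgt leNgt; apply/negP => zc.
  have : sin s ^+ 2 * (r - cmod (z - c)) >= 0 by rewrite mulr_ge0// subr_ge0 ltW.
  nra.
pose L := 2 * (cmod (c - z) + r) + r.
have L0 : 0 <= L by have := cmod_ge0 (c - z); rewrite /L; lra.
have hs s t : cdiff (fun s => homotopy ep s t) s (homotopy_s ep s t).
  rewrite /homotopy /homotopy_s.
  have dsin : is_derive s 1 (fun s => sin s ^+ 2) (2 * sin s * cos s : R).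
    apply: is_derive_eq; rewrite /GRing.scale /= ?expr1; ring.
  have := cdiffD (cdiff_cst (z + ep%:C * cis t) s)
    (cdiffM (cdiff_real dsin) (cdiff_cst (c - z + (r - ep)%:C * cis t) s)).
  by congr cdiff; rewrite mulr0 addr0 add0r.
have ht s t : cdiff (fun t => homotopy ep s t) t (homotopy_t ep s t).
  rewrite /homotopy /homotopy_t.
  have := cdiffD (cdiffD (cdiff_cst z t) (cdiffZ ep%:C (cdiff_cis t)))
   (cdiffZ (sin s ^+ 2)%:C
     (cdiffD (cdiff_cst (c - z) t) (cdiffZ (r - ep)%:C (cdiff_cis t)))).
  by congr cdiff; rewrite !(rmorphD, rmorphN, rmorphM, rmorph1)/=; ring.
have cs t : ccont (fun s => homotopy_s ep s t).
  apply: ccontM; last exact: ccont_cst.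
  split=> /= s; last exact: cst_continuous.
  apply: (@continuousM R R (fun s => 2 * sin s) cos); last exact: continuous_cos.
  by apply: (@continuousM R R (fun=> 2) sin); [exact: cst_continuous|exact: continuous_sin].
have ct s : ccont (fun t => homotopy_t ep s t).
  by do 2 apply: ccontZ; exact: ccont_cis.
have bs s t : cmod (homotopy_s ep s t) <= L.
  rewrite /homotopy_s cmodM cmod_real.
  have t1 : cmod (c - z + (r - ep)%:C * cis t) <= cmod (c - z) + r.
    rewrite (le_trans (cmodD _ _))// lerD2l cmodM cmod_real cmod_cis mulr1 ger0_norm//.
    by rewrite gerBl ltW.
  have t2 : `|2 * sin s * cos s| <= 2.
    rewrite ler_norml; have := cos2Dsin2 s; have := sqr_ge0 (sin s + cos s);
    have := sqr_ge0 (sin s - cos s); nra.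
  have : `|2 * sin s * cos s| * cmod (c - z + (r - ep)%:C * cis t) <= 2 * (cmod (c - z) + r).
    by apply: ler_pM; rewrite ?cmod_ge0.
  by rewrite /L => /le_trans; apply; rewrite lerDl ltW.
have bt s t : cmod (homotopy_t ep s t) <= L.
  have /andP[s0 s1] := sin2_le1 s.
  rewrite /homotopy_t cmodM cmod_real cmodM cmod_cis mulr1.
  rewrite (_ : cmod 'i = 1) ?mulr1; last first.
    by rewrite /cmod normc_def /= expr0n expr1n add0r sqrtr1.
  rewrite ger0_norm; last by rewrite addr_ge0 ?(ltW ep0)// mulr_ge0.
  apply: (@le_trans _ _ r); first nra.
  by rewrite /L lerDr mulr_ge0// addr_ge0 ?cmod_ge0// ltW.
have holo s t : exists D, has_cderiv (fun w => f w / (w - z)) (homotopy ep s t) D.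
  have [D fD] := f_holo (phi_in s t).
  by eexists; apply: has_cderivM fD (has_cderiv_inv (phi_z s t)).
have pihalf_ge0' : 0 <= pi / 2 :> R by rewrite divr_ge0 ?pi_ge0.
have := goursat L0 hs ht cs ct bs bt holo pihalf_ge0' circle_le.
have per s : homotopy ep s (tau + 2 * pi) = homotopy ep s tau.
  by rewrite /homotopy cis_period.
have per' s : homotopy_s ep s (tau + 2 * pi) = homotopy_s ep s tau.
  by rewrite /homotopy_s cis_period.
under [X in _ = cint _ _ X - _]eq_fun do rewrite per per'.
rewrite subrr => /eqP; rewrite subr_eq0 => /eqP E.
have i0 : 'i != 0 :> R[i] by rewrite eq_complex /= oner_eq0 andbF.
have e1 t : homotopy ep (pi / 2) t = c + r%:C * cis t.
  by rewrite /homotopy sin_pihalf expr1n !(rmorphD, rmorphN, rmorph1)/=; ring.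
have e2 t : homotopy ep 0 t = z + ep%:C * cis t.
  by rewrite /homotopy sin0 expr0n /= mul0r addr0.
have e3 t : homotopy_t ep (pi / 2) t = r%:C * ('i * cis t).
  by rewrite /homotopy_t sin_pihalf expr1n mul1r (addrC ep) subrK.
have e4 t : homotopy_t ep 0 t = ep%:C * ('i * cis t).
  by rewrite /homotopy_t sin0 expr0n /= mul0r addr0.
have ccirc a (rho : R) : ccont (fun t => a + rho%:C * cis t).
  by apply: ccontD; [exact: ccont_cst|apply: ccontZ; exact: ccont_cis].
have rz t : c + r%:C * cis t - z != 0 by rewrite -e1 subr_eq0.
have epC : ep%:C != 0 :> R[i] by rewrite -cmod_gt0 cmod_real gtr0_norm.
apply: (mulfI i0); rewrite -!cintZ; last 2 first.
- by apply: ccont_comp => // t; apply: f_holo; rewrite -e2.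
- apply: ccontM; first apply: ccontM.
  + by apply: ccont_comp => // t; apply: f_holo; rewrite -e1.
  + by apply: ccontZ; exact: ccont_cis.
  + by apply: ccont_inv => //; apply: ccontB => //; exact: ccont_cst.
transitivity (circle_int (fun t => f (homotopy ep (pi / 2) t) /
    (homotopy ep (pi / 2) t - z) * homotopy_t ep (pi / 2) t)).
  by apply: eq_cint => t; rewrite e1 e3; ring.
rewrite E; apply: eq_cint => t; rewrite e2 e4 (addrC z) addrK.
by field; rewrite epC cis_neq0.
Qed.

Lemma cauchy_formula :
  circle_int (fun t => f (c + r%:C * cis t) * (r%:C * cis t) / (c + r%:C * cis t - z)) =
  (2 * pi)%:C * f z.
Proof.
have z_le := ltW z_in.
apply/eqP; rewrite -subr_eq0 -cmod_eq0 eq_le cmod_ge0 andbT.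
apply/ler_addgt0Pl => e e0; rewrite addr0.
(* [cint_bound] over a turn multiplies by 2 * 2 pi, which brings e / (4 pi) back to e. *)
have e'0 : 0 < e / (4 * pi) by rewrite divr_gt0// mulr_gt0 ?pi_gt0.
have [D fD] := f_holo z_le.
have [d d0 Hd] := has_cderiv_cont fD e'0.
pose ep := Num.min (d / 2) (r - cmod (z - c)).
have ep0 : 0 < ep by rewrite lt_min divr_gt0// subr_gt0.
have epr : ep <= r - cmod (z - c) by rewrite ge_min lexx orbT.
have epd : ep < d by rewrite gt_min; apply/orP; left; lra.
have cf : ccont (fun t => f (z + ep%:C * cis t)).
  apply: ccont_comp; first by apply: ccontD; [exact: ccont_cst|apply: ccontZ; exact: ccont_cis].
  move=> t; apply: f_holo; rewrite addrAC (le_trans (cmodD _ _))//.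
  by rewrite cmodM cmod_real cmod_cis mulr1 gtr0_norm//; lra.
rewrite (cauchy_shrink ep0 epr) -circle_int_cst -cintB//; last exact: ccont_cst.
have -> : e = 2 * (e / (4 * pi)) * (tau + 2 * pi - tau).
  by move: (pi_gt0 R); generalize (@pi R) => p p0; field; rewrite gt_eqF.
apply: cint_bound; first exact: circle_le.
  by apply: ccontB => //; exact: ccont_cst.
move=> t _; apply/ltW/Hd.
by rewrite addrC addKr cmodM cmod_real cmod_cis mulr1 gtr0_norm.
Qed.

End CauchyFormula.

(** * Differentiating Cauchy integrals under the integral sign *)

Section CauchyKernel.
Variables (w ze : R -> R[i]).
Hypothesis cw : ccont w.
Hypothesis cze : ccont ze.

(** Meant for A = 1 / (w - z - h) and B = 1 / (w - z), which satisfy the hypothesis. The remainder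
    bound depends on w only through [k], hence is uniform along a contour. The induction closes
    because n^2 + (n + 1) <= (n + 1)^2. *)
Lemma inverse_power_taylor (A B h : R[i]) (k : R) n : A - B = h * A * B ->
  cmod A <= k -> cmod B <= k ->
  cmod (A ^+ n - B ^+ n - n%:R * h * B ^+ n.+1) <= n%:R ^+ 2 * k ^+ n.+2 * cmod h ^+ 2.
Proof.
move=> AB Ak Bk; have k0 := le_trans (cmod_ge0 _) Ak.
elim: n => [|n IH]; first by rewrite !expr0 !mul0r subrr subr0 cmod0 expr0n !mul0r.
have -> : A ^+ n.+1 - B ^+ n.+1 - n.+1%:R * h * B ^+ n.+2 =
    A * (A ^+ n - B ^+ n - n%:R * h * B ^+ n.+1) + n.+1%:R * h ^+ 2 * A * B ^+ n.+2.
  have EA : A = B + h * A * B by rewrite -AB addrC subrK.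
  have : (A - B - h * A * B) * (B ^+ n + n.+1%:R * h * B ^+ n.+1) = 0.
    by rewrite AB subrr mul0r.
  move/eqP; rewrite -subr_eq0 => /eqP E; apply/eqP; rewrite -subr_eq0; apply/eqP.
  by rewrite -E -natr1 !exprS; ring.
have cn : cmod (n.+1%:R : R[i]) = n.+1%:R.
  by rewrite -(rmorph_nat (real_complex R)) cmod_real ger0_norm.
apply: le_trans (cmodD _ _) _; rewrite (cmodM A).
rewrite (cmodM _ (B ^+ _)) (cmodM _ A) (cmodM _ (h ^+ 2)) !cmodX cn.
have t1 : cmod A * cmod (A ^+ n - B ^+ n - n%:R * h * B ^+ n.+1) <=
    k * (n%:R ^+ 2 * k ^+ n.+2 * cmod h ^+ 2) by apply: ler_pM; rewrite ?cmod_ge0.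
have t2 : n.+1%:R * cmod h ^+ 2 * cmod A * cmod B ^+ n.+2 <=
    n.+1%:R * cmod h ^+ 2 * k * k ^+ n.+2.
  apply: ler_pM => //; rewrite ?exprn_ge0 ?cmod_ge0//.
  - by rewrite !mulr_ge0 ?exprn_ge0 ?cmod_ge0.
  - by rewrite ler_wpM2l// mulr_ge0// exprn_ge0// cmod_ge0.
  - by rewrite lerXn2r// nnegrE cmod_ge0.
apply: le_trans (lerD t1 t2) _.
have X0 : 0 <= k ^+ n.+3 * cmod h ^+ 2 by rewrite mulr_ge0 ?exprn_ge0 ?cmod_ge0.
rewrite [leLHS](_ : _ = (n%:R ^+ 2 + n.+1%:R) * (k ^+ n.+3 * cmod h ^+ 2)); last first.
  by rewrite [k ^+ n.+3]exprS; ring.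
rewrite -mulrA ler_wpM2r// -natr1 ; have : 0 <= n%:R :> R by []; nra.
Qed.

(** The Taylor remainder of the kernel is O(|h|^2) uniformly in t, so integrating it over the circle
    still leaves O(|h|^2). *)
Lemma cauchy_kernel_cderiv n z (eta : R) : 0 < eta ->
  (forall t, eta <= cmod (ze t - z)) ->
  has_cderiv (fun z => circle_int (fun t => w t / (ze t - z) ^+ n)) z
    (n%:R * circle_int (fun t => w t / (ze t - z) ^+ n.+1)).
Proof.
move=> eta0 far e e0.
have tpi : tau <= tau + 2 * pi := circle_le.
have [M M0 wM] : exists2 M : R, 0 < M & forall t, tau <= t <= tau + 2 * pi -> cmod (w t) <= M.
  have ccw : {within `[tau, tau + 2 * pi], continuous (fun t => cmod (w t) ^+ 2)}.
    by apply: continuous_subspaceT; exact: ccont_cmod2.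
  have [x _ xM] := EVT_max tpi ccw.
  exists (cmod (w x) + 1); first by rewrite ltr_wpDl ?cmod_ge0.
  move=> t tP; have := xM t; rewrite in_itv /= => /(_ tP).
  rewrite ler_sqr ?nnegrE ?cmod_ge0// => /le_trans; apply; by rewrite lerDl.
(* For |h| < eta / 2 both denominators have modulus at least eta / 2. Below, [Q] is the constant of
   the integrated quadratic remainder, plus 1 for positivity. *)
pose k := 2 / eta.
have k0 : 0 < k by rewrite divr_gt0.
pose C := n%:R ^+ 2 * k ^+ n.+2.
have C0 : 0 <= C by rewrite mulr_ge0 ?exprn_ge0// ltW.
pose Q := 2 * (M * C) * (2 * pi) + 1.
have Q0 : 0 < Q.
  rewrite ltr_wpDl//; apply: mulr_ge0; last by rewrite mulr_ge0 ?pi_ge0.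
  by apply: mulr_ge0 => //; apply: mulr_ge0 => //; exact: ltW.
exists (Num.min (eta / 2) (e / Q)); first by rewrite lt_min !divr_gt0.
move=> h; rewrite lt_min => /andP[h1 h2].
have far' t : eta / 2 <= cmod (ze t - (z + h)).
  have := cmodD (ze t - (z + h)) h; have := far t.
  rewrite (_ : ze t - (z + h) + h = ze t - z); [lra|ring].
have nz t : ze t - z != 0 by rewrite -cmod_gt0 (lt_le_trans eta0).
have nz' t : ze t - (z + h) != 0 by rewrite -cmod_gt0 (lt_le_trans _ (far' t))// divr_gt0.
have cker a m : (forall t, ze t - a != 0) -> ccont (fun t => w t / (ze t - a) ^+ m).
  move=> na; apply: ccontM => //; apply: ccont_inv.
    by apply: ccontX; apply: ccontB => //; exact: ccont_cst.
  by move=> t; rewrite expf_neq0.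
rewrite mulrAC -cintB; [|exact: cker..].
rewrite -cintZ; last exact: cker.
rewrite -cintB; last 2 first.
- by apply: ccontB; exact: cker.
- by apply: ccontZ; exact: cker.
apply: (@le_trans _ _ (2 * (M * (C * cmod h ^+ 2)) * (tau + 2 * pi - tau))).
  apply: cint_bound => //.
    by apply: ccontB; [apply: ccontB; exact: cker|apply: ccontZ; exact: cker].
  move=> t tP.
  rewrite [X in cmod X](_ : _ = w t * ((ze t - (z + h))^-1 ^+ n - (ze t - z)^-1 ^+ n -
     n%:R * h * (ze t - z)^-1 ^+ n.+1)); last by rewrite !exprVn; ring.
  rewrite cmodM; apply: ler_pM; rewrite ?cmod_ge0//; first exact: wM.
  apply: inverse_power_taylor.
  - by field; rewrite nz nz'.
  - rewrite cmodV /k -[leRHS]invrK invf_div lef_pV2 ?posrE ?divr_gt0//.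
    by rewrite cmod_gt0.
  - rewrite cmodV /k -[leRHS]invrK invf_div lef_pV2 ?posrE ?divr_gt0 ?cmod_gt0//.
    apply: le_trans (far t); lra.
rewrite [leLHS](_ : _ = (Q - 1) * cmod h * cmod h); last by rewrite /Q; ring.
rewrite ler_wpM2r ?cmod_ge0//; rewrite ltr_pdivlMr// in h2.
have := cmod_ge0 h; nra.
Qed.

End CauchyKernel.

(** * Cauchy's formula for the derivatives *)

Section CauchyDerivatives.
Variables (f : R[i] -> R[i]) (c : R[i]) (r : R).
Hypothesis f_holo : forall w, cmod (w - c) <= r -> exists L, has_cderiv f w L.

Let ze t := c + r%:C * cis t.
Let w t := f (ze t) * (r%:C * cis t).

Let cze : ccont ze.
Proof. by apply: ccontD; [exact: ccont_cst|apply: ccontZ; exact: ccont_cis]. Qed.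

Let cw (r0 : 0 < r) : ccont w.
Proof.
apply: ccontM; last by apply: ccontZ; exact: ccont_cis.
apply: ccont_comp => // t; apply: f_holo.
by rewrite /ze addrC addKr cmodM cmod_real cmod_cis mulr1 gtr0_norm.
Qed.

Lemma has_cderivZ (a : R[i]) (g : R[i] -> R[i]) z L : has_cderiv g z L ->
  has_cderiv (fun z => a * g z) z (a * L).
Proof.
move=> gL; have ca : has_cderiv (fun=> a) z 0.
  by move=> e e0; exists 1 => // h _; rewrite subrr mul0r subr0 cmod0 mulr_ge0 ?cmod_ge0// ltW.
by have := has_cderivM ca gL; rewrite mul0r add0r.
Qed.

(** The induction must hold on the whole open disk: to differentiate [cderiv n f] at a point, its
    integral formula is needed in a neighbourhood of that point. The second conjunct later gives the
    continuity of every derivative. *)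
Lemma cauchy_derivatives n z : cmod (z - c) < r ->
  cderiv n f z = (n`!%:R / (2 * pi)%:C) * circle_int (fun t => w t / (ze t - z) ^+ n.+1) /\
  has_cderiv (cderiv n f) z (cderiv n.+1 f z).
Proof.
have pi0 : (2 * pi)%:C != 0 :> R[i].
  by rewrite -cmod_gt0 cmod_real normr_gt0 mulf_neq0// gt_eqF// ?pi_gt0.
have kernel m z' : cmod (z' - c) < r -> has_cderiv
    (fun z => circle_int (fun t => w t / (ze t - z) ^+ m)) z'
    (m%:R * circle_int (fun t => w t / (ze t - z') ^+ m.+1)).
  move=> z'r; have r0 := le_lt_trans (cmod_ge0 _) z'r.
  apply: (@cauchy_kernel_cderiv w ze _ _ m z' (r - cmod (z' - c))); rewrite ?subr_gt0//.
    exact: cw.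
  move=> t; rewrite lerBlDr.
  have -> : r = cmod (ze t - z' + (z' - c)).
    rewrite (_ : _ + _ = r%:C * cis t); last by rewrite /ze; ring.
    by rewrite cmodM cmod_real cmod_cis mulr1 gtr0_norm.
  exact: cmodD.
have step m : (forall z, cmod (z - c) < r -> cderiv m f z =
      (m`!%:R / (2 * pi)%:C) * circle_int (fun t => w t / (ze t - z) ^+ m.+1)) ->
    forall z, cmod (z - c) < r -> has_cderiv (cderiv m f) z
      ((m.+1`!%:R / (2 * pi)%:C) * circle_int (fun t => w t / (ze t - z) ^+ m.+2)).
  move=> IH z' z'r; have := has_cderivZ (m`!%:R / (2 * pi)%:C) (kernel m.+1 _ z'r).
  rewrite mulrCA mulrA [m.+1%:R * _]mulrA -natrM -factS => H.
  apply: has_cderiv_local H _; exists (r - cmod (z' - c)); first by rewrite subr_gt0.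
  move=> v vr; apply: IH.
  have -> : v - c = (v - z') + (z' - c) by ring.
  by apply: le_lt_trans (cmodD _ _) _; lra.
have formula m : forall z, cmod (z - c) < r -> cderiv m f z =
      (m`!%:R / (2 * pi)%:C) * circle_int (fun t => w t / (ze t - z) ^+ m.+1).
  elim: m => [|m IH] z' z'r; last exact: has_cderiv_derive1 (step m IH z' z'r).
  rewrite fact0 div1r; apply: (mulfI pi0); rewrite mulVKf//.
  rewrite -[LHS](cauchy_formula f_holo z'r).
  by apply: eq_cint => t; rewrite expr1.
move=> zr; split; first exact: formula.
have H := step n (formula n) z zr; by rewrite [cderiv n.+1 f z](has_cderiv_derive1 H).
Qed.

(** At the centre the kernel is a power of [cis t], whose inverse is its conjugate. The derivatives
    thus become Fourier coefficients of f on the circle, the form that Bessel's inequality takes. *)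
Lemma cauchy_coefficient n : 0 < r ->
  cderiv n f c * r%:C ^+ n = (n`!%:R / (2 * pi)%:C) *
    circle_int (fun t => f (c + r%:C * cis t) * (cis t)^* ^+ n).
Proof.
move=> r0; have [] := @cauchy_derivatives n c; first by rewrite subrr cmod0.
move=> -> _; rewrite -[LHS]mulrA [X in _ * X = _]mulrC -cintZ; first congr (_ * _).
  apply: eq_cint => t; rewrite /w /ze (addrC c) addrK exprMn exprS -cisV.
  have rC0 : r%:C != 0 :> R[i] by rewrite -cmod_gt0 cmod_real gtr0_norm.
  by rewrite exprVn (exprS (cis t)); field; rewrite expf_neq0 ?cis_neq0// expf_neq0.
apply: ccontM; first exact: cw.
apply: ccont_inv; first by apply: ccontX; apply: ccontB => //; exact: ccont_cst.
move=> t; rewrite expf_neq0// /ze (addrC c) addrK mulf_neq0 ?cis_neq0//.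
by rewrite -cmod_gt0 cmod_real gtr0_norm.
Qed.

End CauchyDerivatives.

End Circle.

(** * Bessel's inequality on circles *)

Section Bessel.
Variables (R : realType) (tau : R).

Notation circle_int := (cint tau (tau + 2 * pi)).

Lemma cint_conj a b (u : R -> R[i]) : ccont u ->
  cint a b (fun t => (u t)^*) = (cint a b u)^*.
Proof.
move=> [u1 u2]; apply: complex_ext => /=.
  by apply: eq_Rintegral => t _; case: (u t).
rewrite -[RHS]mulN1r -RintegralZl//; last exact: continuous_integrable.
by apply: eq_Rintegral => t _; rewrite mulN1r; case: (u t).
Qed.

Lemma conj_real (x : R) : (x%:C)^* = x%:C :> R[i].
Proof. exact: conjc_real. Qed.

Lemma conj_divr (z : R[i]) (x : R) : (z / x%:C)^* = z^* / x%:C.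
Proof.
transitivity (z^* * (x%:C^-1)^*); first exact: rmorphM.
by congr (_ * _); rewrite -[in RHS]conj_real; exact: fmorphV.
Qed.

Lemma circle_int_cisX k : (0 < k)%N -> circle_int (fun t => cis t ^+ k) = 0.
Proof.
move=> k0; have i0 : 'i != 0 :> R[i] by rewrite eq_complex /= oner_eq0 andbF.
have kC : k%:R != 0 :> R[i] by rewrite pnatr_eq0 -lt0n.
rewrite (@cint_FTC _ _ _ (fun t => (k%:R * 'i)^-1 * cis t ^+ k)).
- by rewrite cis_period subrr.
- exact: circle_le.
- move=> t; have := cdiffZ (k%:R * 'i)^-1 (cdiffX k (cdiff_cis t)).
  congr cdiff; rewrite -[k in RHS]prednK// exprS; field.
  by rewrite kC i0.
- by apply: ccontX; exact: ccont_cis.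
Qed.

Lemma circle_orthogonality m n :
  circle_int (fun t => cis t ^+ m * (cis t)^* ^+ n) = if m == n then (2 * pi)%:C else 0.
Proof.
have [->|mn] := eqVneq m n.
  rewrite -[RHS]mulr1 -(circle_int_cst tau); apply: eq_cint => t.
  by rewrite -exprMn cisJ expr1n.
have [lt_mn|le_nm] := ltnP m n.
  rewrite -[RHS]conjC0 -(@circle_int_cisX (n - m)) ?subn_gt0// -cint_conj.
    apply: eq_cint => t; rewrite rmorphXn /= -[in LHS](subnKC (ltnW lt_mn)) exprD mulrA.
    by rewrite -exprMn cisJ expr1n mul1r.
  by apply: ccontX; exact: ccont_cis.
have lt_nm : (n < m)%N by rewrite ltn_neqAle eq_sym mn.
rewrite -(@circle_int_cisX (m - n)) ?subn_gt0//.
apply: eq_cint => t; rewrite -[in LHS](subnK le_nm) exprD -mulrA.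
by rewrite -exprMn cisJ expr1n mulr1.
Qed.

(** Expand the nonnegative integral of |g - S|^2, where [S] is the orthogonal projection of g onto
    the first N exponentials. As g and [S] share these coefficients, [against] evaluates both of
    their pairings with [S] to the same [T]. *)
Lemma bessel_inequality (g : R -> R[i]) (N : nat) : ccont g ->
  \sum_(n < N) cmod (circle_int (fun t => g t * (cis t)^* ^+ n)) ^+ 2 <=
  2 * pi * \int[lebesgue_measure]_(t in `[tau, tau + 2 * pi]) cmod (g t) ^+ 2.
Proof.
move=> cg; pose a n := circle_int (fun t => g t * (cis t)^* ^+ n).
pose p := 2 * pi : R; have p0 : 0 < p by rewrite mulr_gt0// pi_gt0.
have pC : p%:C != 0 :> R[i] by rewrite -cmod_gt0 cmod_real gtr0_norm.
pose b n := a n / p%:C.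
pose S t := \sum_(n < N) b n * cis t ^+ n.
have cc : ccont (@cis R) := ccont_cis R.
have cJ n : ccont (fun t : R => (cis t)^* ^+ n) by apply: ccontX; exact: (ccont_conj cc).
have cX n : ccont (fun t : R => cis t ^+ n) by apply: ccontX.
have cS : ccont S by apply: ccont_sum => n; apply: ccontZ; exact: cX.
have cgS : ccont (fun t => g t - S t) by apply: ccontB.
pose T := \sum_(n < N) a n * (a n)^* / p%:C.
have bJ n : (b n)^* = (a n)^* / p%:C by exact: conj_divr.
have against h : ccont h -> (forall n : 'I_N, circle_int (fun t => h t * (cis t)^* ^+ n) = a n) ->
    circle_int (fun t => h t * (S t)^*) = T.
  move=> ch hn.
  transitivity (circle_int (fun t => \sum_(n < N) (b n)^* * (h t * (cis t)^* ^+ n))).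
    apply: eq_cint => t; rewrite /S rmorph_sum /= mulr_sumr; apply: eq_bigr => n _.
    by rewrite rmorphM rmorphXn /=; ring.
  rewrite cint_sum; last by move=> n; apply: ccontZ; apply: ccontM.
  by apply: eq_bigr => n _; rewrite cintZ ?hn ?bJ; [ring|apply: ccontM].
have gS : circle_int (fun t => g t * (S t)^*) = T by exact: against.
have Sn (n : 'I_N) : circle_int (fun t => S t * (cis t)^* ^+ n) = a n.
  transitivity (circle_int (fun t => \sum_(m < N) b m * (cis t ^+ m * (cis t)^* ^+ n))).
    by apply: eq_cint => t; rewrite /S mulr_suml; apply: eq_bigr => m _; ring.
  rewrite cint_sum; last by move=> m; apply: ccontZ; apply: ccontM.
  rewrite (bigD1 n)//= cintZ ?circle_orthogonality ?eqxx; last by apply: ccontM.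
  rewrite big1 ?addr0; first by rewrite /b divfK.
  move=> m mn; rewrite cintZ ?circle_orthogonality; last by apply: ccontM.
  by rewrite (inj_eq val_inj) (negPf mn) mulr0.
have SS : circle_int (fun t => S t * (S t)^*) = T by exact: against.
have TJ : T^* = T.
  transitivity (\sum_(n < N) (a n * (a n)^* / p%:C)^*); first exact: rmorph_sum.
  apply: eq_bigr => n _; rewrite conj_divr; congr (_ / _).
  transitivity ((a n)^* * (a n)^*^*); first exact: rmorphM.
  by rewrite conjCK mulrC.
have Sg : circle_int (fun t => S t * (g t)^*) = T.
  rewrite -[RHS]TJ -gS -cint_conj; last by apply: ccontM => //; exact: (ccont_conj cS).
  by apply: eq_cint => t; rewrite rmorphM /= conjCK mulrC.
have normE h : ccont h -> complex.Re (circle_int (fun t => h t * (h t)^*)) =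
    \int[lebesgue_measure]_(t in `[tau, tau + 2 * pi]) cmod (h t) ^+ 2.
  by move=> ch; apply: eq_Rintegral => t _; rewrite mulcJ.
have E : circle_int (fun t => (g t - S t) * (g t - S t)^*) =
    circle_int (fun t => g t * (g t)^*) - T.
  transitivity (circle_int (fun t => (g t * (g t)^* - g t * (S t)^*) -
     (S t * (g t)^* - S t * (S t)^*))).
    by apply: eq_cint => t; rewrite rmorphB /=; ring.
  have cgJ := ccont_conj cg; have cSJ := ccont_conj cS.
  rewrite !cintB ?gS ?SS ?Sg; last first.
  - by apply: ccontB; apply: ccontM.
  - by apply: ccontB; apply: ccontM.
  - by apply: ccontM.
  - by apply: ccontM.
  - by apply: ccontM.
  - by apply: ccontM.
  by rewrite subrr subr0.
have /(congr1 (@complex.Re R)) := E.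
rewrite normE// Re_add Re_opp normE// => E'.
have : 0 <= \int[lebesgue_measure]_(t in `[tau, tau + 2 * pi]) cmod (g t - S t) ^+ 2.
  by apply: Rintegral_ge0 => t _; rewrite exprn_ge0// cmod_ge0.
rewrite E' subr_ge0.
have divC (x y : R) : (x / y)%:C = x%:C / y%:C :> R[i] by rewrite rmorphM fmorphV.
have -> : T = (\sum_(n < N) cmod (a n) ^+ 2 / p)%:C.
  transitivity (\sum_(n < N) (cmod (a n) ^+ 2 / p)%:C); last by symmetry; exact: rmorph_sum.
  by apply: eq_bigr => n _; rewrite mulcJ divC.
by rewrite /= -mulr_suml ler_pdivrMr// mulrC.
Qed.

Lemma circle_derivative_bound (f : R[i] -> R[i]) (c : R[i]) (r : R) (N : nat) : 0 < r ->
  (forall w, cmod (w - c) <= r -> exists L, has_cderiv f w L) ->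
  2 * pi * \sum_(n < N) (cmod (cderiv n f c) / n`!%:R * r ^+ n) ^+ 2 <=
  \int[lebesgue_measure]_(t in `[tau, tau + 2 * pi]) cmod (f (c + r%:C * cis t)) ^+ 2.
Proof.
move=> r0 hf; have p0 : 0 < 2 * pi :> R by rewrite mulr_gt0// pi_gt0.
have cg : ccont (fun t => f (c + r%:C * cis t)).
  apply: ccont_comp.
    by apply: ccontD; [exact: ccont_cst|apply: ccontZ; exact: ccont_cis].
  by move=> t; apply: hf; rewrite addrC addKr cmodM cmod_real cmod_cis mulr1 gtr0_norm.
(* The extra factor 2 pi matches the coefficients of Bessel's inequality, which are not divided by
   the length of the circle. *)
rewrite -(ler_pM2l p0); apply: le_trans (bessel_inequality N cg).
rewrite !mulr_sumr; apply: ler_sum => n _; rewrite le_eqVlt; apply/orP; left; apply/eqP.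
have := congr1 (@cmod R) (cauchy_coefficient tau hf n r0).
rewrite cmodM cmodX cmod_real (gtr0_norm r0) cmodM cmodM cmodV cmod_real (gtr0_norm p0).
have -> : cmod (n`!%:R : R[i]) = n`!%:R.
  by rewrite -(rmorph_nat (real_complex R)) cmod_real ger0_norm.
set I := cmod (cint _ _ _) => E.
have n0 : n`!%:R != 0 :> R by rewrite pnatr_eq0 -lt0n fact_gt0.
have p0' : 2 * pi != 0 :> R by rewrite gt_eqF.
rewrite mulrA -!expr2 -exprMn; congr (_ ^+ 2).
have -> : 2 * pi * (cmod (cderiv n f c) / n`!%:R * r ^+ n) =
  2 * pi / n`!%:R * (cmod (cderiv n f c) * r ^+ n) by ring.
rewrite E; move: (2 * pi) p0' => p p0'; field; by rewrite p0' n0.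
Qed.

End Bessel.

(** * Improper integrals of one variable *)

Section RealIntegrals.
Variable R : realType.
Notation mu := (@lebesgue_measure R).

Lemma FTC_subinterval (F f : R -> R) (a b x y : R) : a < x -> x < y -> y < b ->
  (forall t, a < t < b -> is_derive t 1 F (f t)) ->
  (forall t, a < t < b -> {for t, continuous f}) ->
  (\int[mu]_(t in `[x, y]) (f t)%:E = (F y - F x)%:E)%E.
Proof.
move=> ax xy yb dF cf.
have inab t : x <= t <= y -> a < t < b by move=> /andP[? ?]; apply/andP; split; lra.
have cF t : x <= t <= y -> {for t, continuous F}.
  move=> /inab/dF dFt; apply/differentiable_continuous/derivable1_diffP.
  exact: ex_derive.
rewrite (continuous_FTC2 (F := F))//.
- apply: continuous_in_subspaceT => t; rewrite inE /= in_itv /= => /inab; exact: cf.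
- split=> [t| |].
  + rewrite in_itv /= => /andP[xt ty].
    by have := dF t (inab t ltac:(by rewrite !ltW)) => ?; exact: ex_derive.
  + by apply: cvg_at_right_filter; apply: cF; rewrite lexx ltW.
  + by apply: cvg_at_left_filter; apply: cF; rewrite lexx ltW.
- move=> t; rewrite in_itv /= => /andP[xt ty]; rewrite derive1E.
  by have := dF t (inab t ltac:(by rewrite !ltW)) => ?; exact: derive_val.
Qed.

Lemma continuous_oo_measurable (f : R -> R) (a b : R) :
  (forall t, a < t < b -> {for t, continuous f}) -> measurable_fun `]a, b[ f.
Proof.
move=> cf; apply: open_continuous_measurable_fun; first exact: interval_open.
by move=> t; rewrite inE /= in_itv /=; exact: cf.
Qed.

(** By nonnegativity a single compact subinterval already bounds the integral from below, and
    continuity of F at the ends makes the loss at most e. *)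
Lemma improper_FTC_ge (F f : R -> R) (a b : R) : a < b ->
  (forall t, a < t < b -> is_derive t 1 F (f t)) ->
  (forall t, a < t < b -> {for t, continuous f}) ->
  (forall t, a < t < b -> 0 <= f t) -> {for a, continuous F} -> {for b, continuous F} ->
  ((F b - F a)%:E <= \int[mu]_(t in `]a, b[) (f t)%:E)%E.
Proof.
move=> ab dF cf f0 cFa cFb; apply/lee_addgt0Pr => e e0.
have e2 : 0 < e / 2 by rewrite divr_gt0.
have /cvgrPdist_lt/(_ _ e2)[d1 /= d10 H1] := cFa.
have /cvgrPdist_lt/(_ _ e2)[d2 /= d20 H2] := cFb.
(* A third ensures a + d < b - d and puts both points within their continuity radii. *)
pose d := Num.min (Num.min d1 d2) ((b - a)) / 3.
have dmin0 : 0 < Num.min (Num.min d1 d2) (b - a) by rewrite !lt_min d10 d20 subr_gt0.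
have d0 : 0 < d by rewrite divr_gt0.
have m3 : Num.min (Num.min d1 d2) (b - a) = 3 * d by rewrite /d mulrC divfK.
have [dd1 dd2 dab] : [/\ 3 * d <= d1, 3 * d <= d2 & 3 * d <= b - a].
  by rewrite -m3; split; rewrite !ge_min lexx ?orbT.
have h1 : `|F a - F (a + d)| < e / 2.
  apply: H1 => /=; rewrite opprD addrA subrr add0r normrN gtr0_norm//; lra.
have h2 : `|F b - F (b - d)| < e / 2.
  apply: H2 => /=; rewrite opprB addrC subrK gtr0_norm//; lra.
have sub : (\int[mu]_(t in `[(a + d)%R, (b - d)%R]) (f t)%:E <=
            \int[mu]_(t in `]a, b[) (f t)%:E)%E.
  apply: ge0_subset_integral => //.
  - by apply/measurable_EFinP; exact: continuous_oo_measurable.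
  - move=> t /=; rewrite !in_itv /= => /andP[? ?]; apply/andP; split; lra.
apply: (@le_trans _ _ ((F (b - d) - F (a + d))%:E + e%:E)%E).
  rewrite -EFinD lee_fin; move: h1 h2; rewrite !ltr_norml => /andP[? ?] /andP[? ?]; lra.
rewrite leeD2r// -(FTC_subinterval _ _ _ dF cf)//; lra.
Qed.

(** Monotone convergence along compact subintervals, on each of which the integral is a difference
    of values of F. A bound on the oscillation inside the interval replaces any statement about F at
    the ends. *)
Lemma improper_FTC_le (F f : R -> R) (a b M : R) : a < b ->
  (forall t, a < t < b -> is_derive t 1 F (f t)) ->
  (forall t, a < t < b -> {for t, continuous f}) ->
  (forall t, a < t < b -> 0 <= f t) ->
  (forall s t, a < s < b -> a < t < b -> F t - F s <= M) ->
  (\int[mu]_(t in `]a, b[) (f t)%:E <= M%:E)%E.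
Proof.
move=> ab dF cf f0 FM.
(* The denominator starts at 3 so that a + d n < b - d n from n = 0 on. *)
pose d n : R := (b - a) / n.+3%:R.
have ba0 : 0 < b - a by rewrite subr_gt0.
have d0 n : 0 < d n by rewrite divr_gt0.
have d3 n : 3 * d n <= b - a.
  rewrite /d mulrA ler_pdivrMr// mulrC ler_wpM2l ?(ltW ba0)//.
  by rewrite (ler_nat R 3).
have dS n m : (n <= m)%N -> d m <= d n.
  by move=> nm; rewrite ler_wpM2l ?(ltW ba0)// lef_pV2 ?posrE// ler_nat !ltnS.
pose I n : set R := `[a + d n, b - d n]%classic.
have -> : `]a, b[%classic = \bigcup_n I n.
  apply/seteqP; split=> t /=.
    rewrite in_itv /= => /andP[a_t t_b].
    pose m := Num.min (t - a) (b - t).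
    have m0 : 0 < m by rewrite lt_min !subr_gt0 a_t.
    have [mt1 mt2] : m <= t - a /\ m <= b - t by rewrite !ge_min !lexx orbT.
    exists (Num.bound ((b - a) / m)) => //; rewrite /I /= in_itv /=.
    have : d (Num.bound ((b - a) / m)) <= m.
      rewrite /d ler_pdivrMr// mulrC -ler_pdivrMr//.
      apply: (le_trans (ltW (archi_boundP _))); first by rewrite divr_ge0 ?ltW.
      by rewrite ler_nat; apply/leqW/leqW/leqW.
    move=> dm; apply/andP; split; lra.
  move=> [n _]; rewrite /I /= !in_itv /= => /andP[? ?].
  have := d0 n => ?; apply/andP; split; lra.
have sub n t : I n t -> a < t < b.
  rewrite /I /= in_itv /= => /andP[? ?]; have := d0 n => ?; apply/andP; split; lra.
have cvgI : (\int[mu]_(t in I n) (f t)%:E)%E @[n --> \oo] -->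
    (\int[mu]_(t in \bigcup_n I n) (f t)%:E)%E.
  apply: ge0_nondecreasing_set_cvg_integral.
  - move=> n m nm; apply/subsetPset => t; rewrite /I /= !in_itv /= => /andP[? ?].
    by have := dS _ _ nm => ?; apply/andP; split; lra.
  - by move=> n; exact: measurable_itv.
  - move=> n; apply: (measurable_funS (E := `]a, b[%classic)) => //.
      by move=> t /sub; rewrite /= in_itv.
    by apply/measurable_EFinP; exact: continuous_oo_measurable.
  - by move=> n t /sub tab; rewrite lee_fin; exact: f0.
rewrite -(cvg_lim _ cvgI)//; apply: lime_le; first by apply/cvg_ex; eexists; exact: cvgI.
apply: nearW => n; have := d0 n; have := d3 n => ? ?.
rewrite (FTC_subinterval _ _ _ dF cf); [|lra|lra|lra].
by rewrite lee_fin; apply: FM; apply/andP; split; lra.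
Qed.

(* Equal to 0 for u <= 0, so a weight inv_sqrt (g x) is automatically
   supported where g is positive. *)
Definition inv_sqrt (u : R) : R := (Num.sqrt u)^-1.

Lemma inv_sqrt_ge0 u : 0 <= inv_sqrt u.
Proof. by rewrite invr_ge0 sqrtr_ge0. Qed.

Lemma inv_sqrt_le0 u : u <= 0 -> inv_sqrt u = 0.
Proof. by move=> u0; rewrite /inv_sqrt ler0_sqrtr// invr0. Qed.

Lemma measurable_inv_sqrt : measurable_fun setT inv_sqrt.
Proof.
rewrite (_ : inv_sqrt = (fun u => \1_(`]0%R, +oo[%classic : set R) u * (u `^ (- 2^-1)))).
  apply: measurable_funM; last exact: measurable_powR.
  exact: measurable_indic.
apply/funext => u; rewrite indicE mem_setE in_itv /= andbT.
have [u0|u0] := ltP 0 u; last by rewrite mul0r inv_sqrt_le0.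
by rewrite mul1r powRN powR12_sqrt ?ltW.
Qed.

Lemma continuous_inv_sqrt_comp (g : R -> R) (t : R) : {for t, continuous g} -> 0 < g t ->
  {for t, continuous (fun t => inv_sqrt (g t))}.
Proof.
move=> cg g0; apply: (@continuousV R R^o (fun t => Num.sqrt (g t))).
  by rewrite gt_eqF// sqrtr_gt0.
apply: (@continuous_comp _ _ _ g Num.sqrt); [exact: cg|exact: sqrt_continuous].
Qed.

(** * Moments of the radial weight *)

Section Radial.
Variables (x : R) (x0 : 0 < x).

(* A primitive of r^(2n+1) / sqrt (x^2 - 2 r^2); the recursion is the derivative
   of r^(2n+2) sqrt (x^2 - 2 r^2). *)
Fixpoint radial_primitive n (r : R) : R :=
  if n is m.+1 then (m.+1%:R * x ^+ 2 * radial_primitive m r -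
    r ^+ m.+1.*2 * Num.sqrt (x ^+ 2 - 2 * r ^+ 2) / 2) / (m.*2.+3)%:R
  else Num.sqrt (x ^+ 2 - 2 * r ^+ 2) * (- 2^-1).

Lemma continuous_radial_radicand : continuous (fun r : R => x ^+ 2 - 2 * r ^+ 2).
Proof.
move=> t; apply: (@continuousB _ R^o R (fun=> x ^+ 2) (fun r => 2 * r ^+ 2)).
  exact: cst_continuous.
apply: (@continuousM R R (fun=> 2) (fun r => r ^+ 2)); first exact: cst_continuous.
exact: exprn_continuous.
Qed.

Lemma continuous_radial_primitive n : continuous (radial_primitive n).
Proof.
have csq : continuous (fun r : R => Num.sqrt (x ^+ 2 - 2 * r ^+ 2)).
  move=> t; apply: (@continuous_comp _ _ _ (fun r : R => x ^+ 2 - 2 * r ^+ 2) Num.sqrt).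
    exact: continuous_radial_radicand.
  exact: sqrt_continuous.
have cZ (g : R -> R) (k : R) : continuous g -> continuous (fun r => g r * k).
  by move=> cg t; apply: (@continuousM R R g (fun=> k)); [exact: cg|exact: cst_continuous].
elim: n => [|n IH] /=.
  exact: cZ.
apply: (cZ (fun r => _ - _)) => t.
apply: (@continuousB _ R^o R (fun r => _ * _ * _) (fun r => _ * _)).
  apply: (@continuousM R R (fun=> _) (radial_primitive n)); [exact: cst_continuous|exact: IH].
apply: (cZ (fun r => _ * _)) => {}t.
by apply: (@continuousM R R (fun r => r ^+ _)); [exact: exprn_continuous|exact: csq].
Qed.

Lemma radial_primitive_edge n : radial_primitive n (x / Num.sqrt 2) = 0.
Proof.
have e : x ^+ 2 - 2 * (x / Num.sqrt 2) ^+ 2 = 0.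
  by rewrite expr_div_n sqr_sqrtr//; field.
elim: n => [|n IH] /=; rewrite e sqrtr0 ?mul0r//.
by rewrite IH !mulr0 mul0r subrr mul0r.
Qed.

(** At r = 0 the boundary term drops out, so each step of the recursion multiplies by (n + 1) x^2 /
    (2n + 3), starting from x / 2. The factorials are this product in closed form. *)
Lemma radial_primitive0 n :
  - radial_primitive n 0 = 2 ^+ n * x ^+ n.*2.+1 * n`!%:R ^+ 2 / (n.*2.+1)`!%:R / 2.
Proof.
have sq : Num.sqrt (x ^+ 2 - 2 * 0 ^+ 2) = x.
  by rewrite expr0n mulr0 subr0 sqrtr_sqr gtr0_norm.
elim: n => [|n IH] /=.
  by rewrite sq !expr0 !fact0 expr1n expr1 divr1 mul1r mulr1; ring.
have -> : (0 : R) ^+ n.+1.*2 = 0 by rewrite doubleS expr0n.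
rewrite !mul0r subr0 -mulNr -mulrN IH.
have n0 : 0 <= n%:R :> R by [].
have f0 : (n * 2)`!%:R != 0 :> R by rewrite pnatr_eq0 -lt0n fact_gt0.
rewrite doubleS !factS !natrM !exprS -!natr1 -muln2 natrM.
field; rewrite f0 /=; apply/and3P; split; rewrite gt_eqF//; lra.
Qed.

Lemma radial_primitive_derive n (t : R) : 0 < x ^+ 2 - 2 * t ^+ 2 ->
  is_derive t 1 (radial_primitive n) (t ^+ n.*2.+1 * inv_sqrt (x ^+ 2 - 2 * t ^+ 2)).
Proof.
move=> rad0; set s := Num.sqrt (x ^+ 2 - 2 * t ^+ 2).
have s0 : 0 < s by rewrite sqrtr_gt0.
have s2 : s ^+ 2 = x ^+ 2 - 2 * t ^+ 2 by rewrite sqr_sqrtr// ltW.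
have dsq : is_derive t 1 (fun r : R => Num.sqrt (x ^+ 2 - 2 * r ^+ 2)) (- 2 * t / s).
  have dr : is_derive t 1 (fun r : R => x ^+ 2 - 2 * r ^+ 2) (- 4 * t).
    by apply: is_derive_eq; rewrite /GRing.scale /= ?expr1; ring.
  have dc := @is_derive1_comp _ Num.sqrt (fun r : R => x ^+ 2 - 2 * r ^+ 2) t _ _
    (is_derive1_sqrt rad0) dr.
  by apply: (is_derive_eq dc); rewrite -/s; field; rewrite gt_eqF.
elim: n => [|n IH].
  apply: (is_derive_eq (is_deriveM dsq (is_derive_cst (- 2^-1 : R) t 1))).
  by rewrite /GRing.scale /= /inv_sqrt -/s expr1; field; rewrite gt_eqF.
have dpow : is_derive t 1 (fun r : R => r ^+ n.+1.*2) (n.+1.*2%:R * t ^+ n.*2.+1).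
  rewrite (_ : (fun r : R => _) = (id : R -> R) ^+ n.+1.*2); last first.
    by apply/funext => r; rewrite exprfctE.
  by apply: (is_derive_eq (is_deriveX _ (is_derive_id t 1))); rewrite /GRing.scale /=; ring.
have dF := is_deriveM (is_deriveB (is_deriveM (is_derive_cst (n.+1%:R * x ^+ 2 : R) t 1) IH)
  (is_deriveM (is_deriveM dpow dsq) (is_derive_cst (2^-1 : R) t 1)))
  (is_derive_cst ((n.*2.+3)%:R^-1 : R) t 1).
apply: (is_derive_eq dF); rewrite /GRing.scale /= /inv_sqrt -/s !mulr0 !add0r addr0.
have x2 : x ^+ 2 = s ^+ 2 + 2 * t ^+ 2 by rewrite s2 subrK.
rewrite !doubleS (exprS t n.*2.+2) (exprS t n.*2.+1) x2.
rewrite -!natr1 -!muln2 natrM -natr1.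
move: (t ^+ (n * 2).+1) => P; have n0 : 0 <= n%:R :> R by [].
field; rewrite (gt_eqF s0) /=; rewrite gt_eqF//; lra.
Qed.

Lemma radial_moment n : ((2 ^+ n * x ^+ n.*2.+1 * n`!%:R ^+ 2 / (n.*2.+1)`!%:R / 2)%:E <=
  \int[mu]_(r in `]0%R, (x / Num.sqrt 2)%R[)
     (r ^+ n.*2.+1 * inv_sqrt (x ^+ 2 - 2 * r ^+ 2))%:E)%E.
Proof.
have sq2 : 0 < Num.sqrt 2 :> R by rewrite sqrtr_gt0.
have inside t : 0 < t < x / Num.sqrt 2 -> 0 < x ^+ 2 - 2 * t ^+ 2.
  move=> /andP[t0 tx]; rewrite subr_gt0.
  have -> : x ^+ 2 = 2 * (x / Num.sqrt 2) ^+ 2 by rewrite expr_div_n sqr_sqrtr//; field.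
  by rewrite ltr_pM2l// ltrXn2r// ?nnegrE ?ltW ?divr_gt0.
have <- : radial_primitive n (x / Num.sqrt 2) - radial_primitive n 0 =
    2 ^+ n * x ^+ n.*2.+1 * n`!%:R ^+ 2 / (n.*2.+1)`!%:R / 2.
  by rewrite radial_primitive_edge sub0r radial_primitive0.
apply: improper_FTC_ge.
- by rewrite divr_gt0.
- by move=> t /inside; exact: radial_primitive_derive.
- move=> t /inside t0.
  apply: (@continuousM R R (fun r => r ^+ _) (fun r => inv_sqrt _)); first exact: exprn_continuous.
  apply: (continuous_inv_sqrt_comp (g := fun r => x ^+ 2 - 2 * r ^+ 2)) => //.
  exact: continuous_radial_radicand.
- by move=> t /andP[t0 _]; rewrite mulr_ge0 ?exprn_ge0 ?inv_sqrt_ge0// ltW.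
- exact: continuous_radial_primitive.
- exact: continuous_radial_primitive.
Qed.

End Radial.

(** The integrand vanishes outside |x - m| < sqrt v, where asin ((x - m) / sqrt v) is a primitive of
    oscillation at most pi. The bound does not depend on m, v or D, so it can be used at every point
    of the plane at once. *)
Lemma arcsine_integral (m v : R) (D : set R) : measurable D ->
  (\int[mu]_(x in D) (inv_sqrt (v - (x - m) ^+ 2))%:E <= pi%:E)%E.
Proof.
move=> mD.
have mW : measurable_fun setT (fun x : R => inv_sqrt (v - (x - m) ^+ 2)).
  apply: measurableT_comp; first exact: measurable_inv_sqrt.
  apply: measurable_funB => //; apply: measurable_funX; exact: measurable_funB.
have [v0|v0] := leP v 0.
  rewrite integral0_eq ?lee_fin ?pi_ge0// => x _; rewrite inv_sqrt_le0//.
  by rewrite subr_le0 (le_trans v0)// sqr_ge0.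
pose rho := Num.sqrt v; have rho0 : 0 < rho by rewrite sqrtr_gt0.
have rho2 : rho ^+ 2 = v by rewrite sqr_sqrtr// ltW.
have inside x : m - rho < x < m + rho -> -1 < (x - m) / rho < 1.
  by rewrite ltr_pdivlMr// ltr_pdivrMr// mulN1r mul1r => /andP[? ?]; apply/andP; split; lra.
apply: (@le_trans _ _ (\int[mu]_(x in `](m - rho)%R, (m + rho)%R[)
    (inv_sqrt (v - (x - m) ^+ 2))%:E)%E).
  rewrite [leLHS]integral_mkcond [leRHS]integral_mkcond.
  apply: ge0_le_integral => //.
  - by move=> x _; apply: erestrict_ge0 => {}x _; rewrite lee_fin inv_sqrt_ge0.
  - apply/(measurable_restrictT _ _).1 => //; apply/measurable_EFinP.
    exact: measurable_funTS.
  - apply/(measurable_restrictT _ _).1 => //; apply/measurable_EFinP.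
    exact: measurable_funTS.
  move=> x _; rewrite !patchE.
  case: ifPn => [_|_]; last by case: ifPn => // _; rewrite lee_fin inv_sqrt_ge0.
  case: ifPn => // /negP xin; rewrite lee_fin inv_sqrt_le0// -rho2 subr_le0.
  rewrite -[rho]ger0_norm ?(ltW rho0)// real_normK ?num_real// -[leRHS]real_normK ?num_real//.
  rewrite lerXn2r ?nnegrE// ?(ltW rho0)// leNgt; apply/negP => xm; apply: xin.
  by rewrite inE /= in_itv /=; move: xm; rewrite ltr_norml => /andP[? ?]; apply/andP; split; lra.
apply: (@improper_FTC_le (fun x => asin ((x - m) / rho))); first lra.
- move=> x xin; have := inside _ xin => x1.
  have dl : is_derive x 1 (fun x : R => (x - m) / rho) rho^-1.
    by apply: is_derive_eq; rewrite /GRing.scale /=; ring.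
  have dc := @is_derive1_comp _ asin (fun x : R => (x - m) / rho) x _ _
    (is_derive1_asin x1) dl.
  apply: is_derive_eq; rewrite /inv_sqrt -invfM; congr (_^-1).
  rewrite -[X in _ * X]ger0_norm ?(ltW rho0)// -sqrtr_sqr -sqrtrM; last first.
    by rewrite subr_ge0; move: x1 => /andP[? ?]; nra.
  by congr Num.sqrt; rewrite -rho2; field; rewrite gt_eqF.
- move=> x xin; apply: (continuous_inv_sqrt_comp (g := fun x => v - (x - m) ^+ 2)).
    apply: (@continuousB _ R^o R (fun=> v) (fun x => (x - m) ^+ 2)); first exact: cst_continuous.
    apply: (@continuous_comp _ _ _ (fun x : R => x - m) (fun x => x ^+ 2)); last exact: exprn_continuous.
    by apply: (@continuousB _ R^o R id (fun=> m)); [exact: cvg_id|exact: cst_continuous].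
  by move: xin => /andP[? ?]; rewrite -rho2; nra.
- by move=> x _; exact: inv_sqrt_ge0.
- move=> s t /inside/andP[/ltW s1 /ltW s2] /inside/andP[/ltW t1 /ltW t2].
  have := asin_geNpi2 (ltac:(by rewrite s1 s2) : -1 <= (s - m) / rho <= 1).
  have := asin_lepi2 (ltac:(by rewrite t1 t2) : -1 <= (t - m) / rho <= 1).
  lra.
Qed.

End RealIntegrals.

(** * Substitutions and measurability in the plane *)

Section PlaneIntegrals.
Variable R : realType.
Notation mu := (@lebesgue_measure R).
Local Open Scope ereal_scope.

(** The right-hand side is k times a push-forward measure; it agrees with Lebesgue measure on
    half-open intervals, which determine the latter. *)
Lemma lebesgue_measure_affine (k l : R) : (0 < k)%R -> forall A : set R, measurable A ->
  mu A = k%:E * mu ((fun t => k * t + l)%R @^-1` A).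
Proof.
move=> k0.
have mphi : measurable_fun [set: measurableTypeR R]
    ((fun t => k * t + l)%R : measurableTypeR R -> measurableTypeR R).
  by apply: measurable_funD => //; exact: measurable_funM.
pose nu : {measure set (measurableTypeR R) -> \bar R} :=
  mscale (NngNum (ltW k0)) (measure_function_pushforward__canonical__measure_function_Measure mu mphi).
move=> A mA; rewrite (_ : mu A = nu A)//.
apply: lebesgue_measure_unique => // _ [[a b]] _ <-.
transitivity (k%:E * mu ((fun t => k * t + l)%R @^-1` `]a, b]%classic)) => //.
rewrite (_ : _ @^-1` _ = `](a - l) / k, (b - l) / k]%classic)%R; last first.
  apply/seteqP; split=> t /=; rewrite !in_itv /= ltr_pdivrMr// ler_pdivlMr//;
    by rewrite ltrBlDr lerBrDr mulrC.
rewrite !lebesgue_measure_itv /= !lte_fin ltr_pM2r ?invr_gt0// ltrD2r.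
case: ifPn => _; last by rewrite mule0.
by rewrite -!EFinD -EFinM; congr (_%:E); field; rewrite gt_eqF.
Qed.

Lemma ge0_integral_affine_pos (k l : R) (h : R -> \bar R) : (0 < k)%R ->
  measurable_fun setT h -> (forall x, 0 <= h x) ->
  \int[mu]_x h x = k%:E * \int[mu]_x h (k * x + l)%R.
Proof.
move=> k0 mh h0.
have mphi : measurable_fun [set: measurableTypeR R]
    ((fun t => k * t + l)%R : measurableTypeR R -> measurableTypeR R).
  by apply: measurable_funD => //; exact: measurable_funM.
pose push := measure_function_pushforward__canonical__measure_function_Measure mu mphi.
transitivity (\int[mscale (NngNum (ltW k0)) push]_x h x).
  by apply: eq_measure_integral => A mA _; exact: lebesgue_measure_affine.
rewrite ge0_integral_mscale//=; congr (_ * _).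
by rewrite ge0_integral_pushforward.
Qed.

Lemma ge0_integral_opp (h : R -> \bar R) : measurable_fun setT h -> (forall x, 0 <= h x) ->
  \int[mu]_x h x = \int[mu]_x h (- x)%R.
Proof.
move=> mh h0.
transitivity (\int[pushforward mu (-%R : _ -> measurableTypeR R)]_x h x).
  by apply: eq_measure_integral => A mA _; exact/esym/lebesgue_measureN.
by rewrite ge0_integral_pushforward//; exact: oppr_measurable.
Qed.

(** Negative factors are included because y = x m is later substituted on vertical lines with x of
    either sign. *)
Lemma ge0_integral_scale (k : R) (h : R -> \bar R) : k != 0%R ->
  measurable_fun setT h -> (forall x, 0 <= h x) ->
  \int[mu]_x h x = `|k|%:E * \int[mu]_x h (k * x)%R.
Proof.
move=> k0 mh h0; have [k_gt0|k_le0] := ltP 0%R k.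
  rewrite (ge0_integral_affine_pos 0 k_gt0)// gtr0_norm//.
  by under eq_integral do rewrite addr0.
have k_gt0 : (0 < - k)%R by rewrite oppr_gt0 lt_neqAle k0.
rewrite (ge0_integral_affine_pos 0 k_gt0)// ler0_norm//; congr (_ * _).
rewrite ge0_integral_opp//.
- by apply: eq_integral => x _; rewrite addr0 mulrNN.
- by apply: measurableT_comp => //; apply: measurable_funD => //; exact: measurable_funM.
Qed.

Lemma ge0_integral_shift (l : R) (h : R -> \bar R) :
  measurable_fun setT h -> (forall x, 0 <= h x) ->
  \int[mu]_x h x = \int[mu]_x h (x + l)%R.
Proof.
move=> mh h0; rewrite (ge0_integral_affine_pos l ltr01)// mul1e.
by under eq_integral do rewrite mul1r.
Qed.

(** Measurability here refers to the product sigma-algebra, so the open set is written as a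
    countable union of boxes with rational centres and radii 1 / (n + 1). *)
Lemma open_box_measurable (U : set (R * R)) :
  (forall p, U p -> exists2 d : R, (0 < d)%R & forall q,
     (`|q.1 - p.1| < d)%R -> (`|q.2 - p.2| < d)%R -> U q) -> measurable U.
Proof.
move=> oU.
pose box (a b e : R) : set (R * R) := `](a - e)%R, (a + e)%R[%classic `*` `](b - e)%R, (b + e)%R[%classic.
pose F (a b : rat) (n : nat) :=
  if `[< box (ratr a) (ratr b) (n.+1%:R^-1)%R `<=` U >] then
    box (ratr a) (ratr b) (n.+1%:R^-1)%R else set0.
rewrite (_ : U = \bigcup_a \bigcup_b \bigcup_n F a b n).
  have mF a b n : measurable (F a b n).
    rewrite /F; case: asboolP => // _.
    by apply: measurableX; exact: measurable_itv.
  have mFab a b : measurable (\bigcup_n F a b n) by exact: bigcupT_measurable.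
  have mFa a : measurable (\bigcup_b \bigcup_n F a b n).
    exact: bigcupT_measurable_rat.
  exact: bigcupT_measurable_rat.
apply/seteqP; split=> [p Up|p [a _ [b _ [n _]]]]; last first.
  by rewrite /F; case: asboolP => // bU /bU.
have [d d0 dU] := oU _ Up.
(* The rational centre lies within e of p, so every point of its box of radius e is within 2 e < d
   of p. *)
have [n nd] : exists n : nat, (2 * n.+1%:R^-1 < d)%R.
  exists (Num.bound (2 / d)); rewrite ltr_pdivrMr// mulrC -ltr_pdivrMr//.
  apply: lt_trans (archi_boundP _) _; first by rewrite divr_ge0// ltW.
  by rewrite ltr_nat.
set e : R := (n.+1%:R^-1)%R in nd.
have e0 : (0 < e)%R by rewrite invr_gt0.
have [a /[!in_itv]/= /andP[a1 a2]] := rat_in_itvoo (ltac:(lra) : p.1 - e < p.1 + e)%R.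
have [b /[!in_itv]/= /andP[b1 b2]] := rat_in_itvoo (ltac:(lra) : p.2 - e < p.2 + e)%R.
exists a => //; exists b => //; exists n => //.
have bU : box (ratr a) (ratr b) (n.+1%:R^-1)%R `<=` U.
  move=> q [] /=; rewrite !in_itv /= => /andP[q1 q2] /andP[q3 q4].
  apply: dU; rewrite ltr_norml; apply/andP; split; rewrite -/e in q1 q2 q3 q4; lra.
rewrite /F; case: asboolP => // _; split => /=; rewrite in_itv /= -/e; apply/andP; split; lra.
Qed.

(** The substitution t = atan m is made on the compact intervals [-n, n]; their images exhaust the
    open half turn, and monotone convergence is applied on both sides. *)
Lemma tan_substitution (g : R -> R) : continuous g -> (forall t, 0 <= g t)%R ->
  \int[mu]_m ((1 + m ^+ 2)^-1 * g (atan m))%:E =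
  \int[mu]_(t in `](- (pi / 2))%R, (pi / 2)%R[) (g t)%:E.
Proof.
move=> cg g0.
have catan : continuous (@atan R) by exact: continuous_atan.
have cinv : continuous (fun m : R => (1 + m ^+ 2)^-1)%R.
  move=> m; apply: (@continuousV R R^o (fun m : R => 1 + m ^+ 2)%R).
    by rewrite gt_eqF// ltr_pwDl// sqr_ge0.
  apply: (@continuousD _ R^o R (fun=> 1%R) (fun m => m ^+ 2)%R); first exact: cst_continuous.
  exact: exprn_continuous.
have cgatan : continuous (fun m => g (atan m)).
  by move=> m; apply: (@continuous_comp _ _ _ (@atan R) g); [exact: catan|exact: cg].
have cprod : continuous (fun m : R => (1 + m ^+ 2)^-1 * g (atan m))%R.
  move=> m.
  by apply: (@continuousM R R (fun m : R => (1 + m ^+ 2)^-1)%R (fun m => g (atan m)));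
    [exact: cinv|exact: cgatan].
pose I n : set R := `[- n%:R, n%:R]%classic%R.
pose J n : set R := `[atan (- n%:R), atan n%:R]%classic%R.
have dE : (@atan R)^`()%classic = (fun m => (1 + m ^+ 2)^-1)%R.
  by apply/funext; exact: derive1_atan.
have eqIJ n : \int[mu]_(m in I n) ((1 + m ^+ 2)^-1 * g (atan m))%:E =
    \int[mu]_(t in J n) (g t)%:E.
  rewrite /J integration_by_substitution_increasing.
  - apply: eq_integral => m _; rewrite dE.
    by rewrite -[RHS]/((g (atan m) * (1 + m ^+ 2)^-1)%:E)%R mulrC.
  - by rewrite -subr_ge0 opprK addr_ge0.
  - by move=> x y _ _; exact: lt_atan.
  - by move=> x _; rewrite dE; exact: cinv.
  - rewrite dE; apply/cvg_ex; eexists; apply: cvg_at_right_filter; exact: cinv.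
  - rewrite dE; apply/cvg_ex; eexists; apply: cvg_at_left_filter; exact: cinv.
  - split=> [x _| |]; first exact: derivable_atan.
      by apply: cvg_at_right_filter; exact: catan.
    by apply: cvg_at_left_filter; exact: catan.
  - exact: continuous_subspaceT.
have mono (f : R -> R) (S : nat -> set R) : measurable_fun setT f -> (forall t, 0 <= f t)%R ->
    (forall n, measurable (S n)) -> (forall n m, (n <= m)%N -> S n `<=` S m) ->
    \int[mu]_(t in S n) (f t)%:E @[n --> \oo] --> \int[mu]_(t in \bigcup_n S n) (f t)%:E.
  move=> mf f0 mS ndS; apply: ge0_nondecreasing_set_cvg_integral => //.
  - by move=> n m nm; apply/subsetPset; exact: ndS.
  - by move=> n; apply/measurable_EFinP; exact: measurable_funTS.
  - by move=> n t _; rewrite lee_fin.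
have cI := mono (fun m => (1 + m ^+ 2)^-1 * g (atan m))%R I.
have cJ := mono g J.
have UI : \bigcup_n I n = setT.
  apply/seteqP; split=> // m _; exists (Num.bound `|m|) => //.
  by have := ltW (archi_boundP (normr_ge0 m)); rewrite ler_norml /I /= in_itv.
have UJ : \bigcup_n J n = `](- (pi / 2))%R, (pi / 2)%R[%classic.
  apply/seteqP; split=> [t [n _]|t] /=.
    rewrite /J /= !in_itv /= => /andP[t1 t2]; rewrite (lt_le_trans _ t1) ?atan_gtNpi2//=.
    by rewrite (le_lt_trans t2)// atan_ltpi2.
  rewrite in_itv /= => /andP[t1 t2].
  have ta : t \in `](- (pi / 2)), (pi / 2)[%R by rewrite in_itv /= t1.
  exists (Num.bound `|tan t|) => //; rewrite /J /= in_itv /=.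
  have := ltW (archi_boundP (normr_ge0 (tan t))); rewrite ler_norml => /andP[l1 l2].
  by rewrite -{2 3}(tanK ta); apply/andP; split; exact: le_atan.
have mono_J n m : (n <= m)%N -> J n `<=` J m.
  move=> nm t; rewrite /J /= !in_itv /= => /andP[t1 t2]; apply/andP; split.
    by apply: le_trans t1; apply: le_atan; rewrite lerN2 ler_nat.
  by apply: (le_trans t2); apply: le_atan; rewrite ler_nat.
have mono_I n m : (n <= m)%N -> I n `<=` I m.
  move=> nm t; rewrite /I /= !in_itv /= => /andP[t1 t2]; apply/andP; split.
    by apply: le_trans t1; rewrite lerN2 ler_nat.
  by apply: (le_trans t2); rewrite ler_nat.
have prod0 (m : R) : (0 <= (1 + m ^+ 2)^-1 * g (atan m))%R.
  by apply: mulr_ge0 => //; rewrite invr_ge0 addr_ge0// sqr_ge0.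
have {}cI := cI (continuous_measurable_fun cprod) prod0 (fun=> measurable_itv _) mono_I.
have {}cJ := cJ (continuous_measurable_fun cg) g0 (fun=> measurable_itv _) mono_J.
rewrite -UJ -UI -(cvg_lim _ cI)// -(cvg_lim _ cJ)//.
by under eq_fun do rewrite eqIJ.
Qed.

End PlaneIntegrals.

(** * Polar coordinates *)

Section Polar.
Variable R : realType.
Notation mu := (@lebesgue_measure R).
Local Open Scope ereal_scope.
Variable h : R * R -> R.
Hypothesis mh : measurable_fun setT h.
Hypothesis h0 : forall p, (0 <= h p)%R.
(** The angular substitution needs continuity along circles, whereas h as a whole is only
    measurable. The intended h has a singular weight depending on the radius alone, which is
    constant on each circle. *)
Hypothesis h_circle : forall r : R, continuous (fun t => h (r * cos t, r * sin t)%R).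

Let half_circle r := \int[mu]_(t in `](- (pi / 2))%R, (pi / 2)%R[) (h (r * cos t, r * sin t)%R)%:E.

(** The coordinates are a signed radius and a slope m, and (1 + m^2)^-1 is the density of the angle
    atan m. The factor |r| is kept apart in [polar_kernel] so that the bare circle integral is also
    measurable in r. *)
Let angular_kernel (p : R * R) : R :=
  ((1 + p.2 ^+ 2)^-1 * h (p.1 * cos (atan p.2), p.1 * sin (atan p.2)))%R.

Let polar_kernel (p : R * R) : R := (`|p.1| * angular_kernel p)%R.

Let angular_kernel_ge0 p : (0 <= angular_kernel p)%R.
Proof. by rewrite mulr_ge0// invr_ge0 addr_ge0// sqr_ge0. Qed.

Let polar_kernel_ge0 p : (0 <= polar_kernel p)%R.
Proof. by rewrite mulr_ge0. Qed.

Let measurable_angular_kernel : measurable_fun setT angular_kernel.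
Proof.
have m1 : measurable_fun [set: R * R] fst by exact: measurable_fst.
have m2 : measurable_fun [set: R * R] snd by exact: measurable_snd.
have mcosatan : measurable_fun [set: R] (fun m : R => cos (atan m)).
  apply: continuous_measurable_fun => m.
  apply: (@continuous_comp _ _ _ (@atan R) cos); [exact: continuous_atan|exact: continuous_cos].
have msinatan : measurable_fun [set: R] (fun m : R => sin (atan m)).
  apply: continuous_measurable_fun => m.
  apply: (@continuous_comp _ _ _ (@atan R) sin); [exact: continuous_atan|exact: continuous_sin].
have minv : measurable_fun [set: R] (fun m : R => (1 + m ^+ 2)^-1)%R.
  apply: continuous_measurable_fun => m.
  apply: (@continuousV R R^o (fun m : R => 1 + m ^+ 2)%R).
    by rewrite gt_eqF// ltr_pwDl// sqr_ge0.
  apply: (@continuousD _ R^o R (fun=> 1%R) (fun m => m ^+ 2)%R); first exact: cst_continuous.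
  exact: exprn_continuous.
apply: measurable_funM; first exact: (measurableT_comp minv).
apply: measurableT_comp => //; apply: measurable_fun_pair; apply: measurable_funM => //.
  exact: (measurableT_comp mcosatan).
exact: (measurableT_comp msinatan).
Qed.

Let measurable_polar_kernel : measurable_fun setT polar_kernel.
Proof. by apply: measurable_funM => //; exact: measurableT_comp. Qed.

Let polar_kernel_integral r :
  \int[mu]_m (polar_kernel (r, m))%:E = `|r|%:E * half_circle r.
Proof.
rewrite /half_circle -(@tan_substitution _ (fun t => h (r * cos t, r * sin t)%R))//.
have mang : measurable_fun setT (EFin \o angular_kernel) by exact/measurable_EFinP.
rewrite -ge0_integralZl_EFin//.
- by move=> m _; rewrite lee_fin; exact: (angular_kernel_ge0 (r, m)).
- exact: (measurable_fun_pair2 r mang).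
Qed.

Let fin_kernel := EFin \o polar_kernel.

Let measurable_fin_kernel : measurable_fun setT fin_kernel.
Proof. exact/measurable_EFinP. Qed.

Let fin_kernel_ge0 p : 0 <= fin_kernel p.
Proof. by rewrite lee_fin. Qed.

(* On the line y = m x the substitution is x = r cos (atan m), with r of any
   sign, so that no half-plane has to be treated separately. *)
Lemma polar_coordinates_line :
  \int[mu \x mu]_p (h p)%:E = \int[mu]_r (`|r|%:E * half_circle r).
Proof.
have mH : measurable_fun setT (EFin \o h) by exact/measurable_EFinP.
have H0 p : 0 <= (EFin \o h) p by rewrite lee_fin.
pose K (p : R * R) : \bar R := (`|p.1| * h (p.1, p.1 * p.2))%:E%R.
have mK : measurable_fun setT K.
  apply/measurable_EFinP; apply: measurable_funM; first exact: measurableT_comp.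
  apply: measurableT_comp => //; apply: measurable_fun_pair => //.
  exact: measurable_funM.
have K0 p : 0 <= K p by rewrite lee_fin mulr_ge0.
rewrite (@fubini_tonelli1 _ _ _ _ _ mu mu (EFin \o h))// /fubini_F.
transitivity (\int[mu]_x \int[mu]_m K (x, m)).
  have mF := measurable_fun_fubini_tonelli_F (m2 := mu) _ mH H0.
  have mFK := measurable_fun_fubini_tonelli_F (m2 := mu) _ mK K0.
  (* The scaling y = x m degenerates on the null line x = 0, which is therefore removed and put
     back. *)
  have punctured (F : R -> \bar R) : measurable_fun setT F ->
      \int[mu]_(x in [set: R] `\ 0%R) F x = \int[mu]_x F x.
    move=> mF'; apply: integral_setD1; last exact: (measurable_funTS mF').
    exact: measurableD.
  transitivity (\int[mu]_(x in [set: R] `\ 0%R) \int[mu]_y (EFin \o h) (x, y)).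
    by symmetry; exact: punctured.
  transitivity (\int[mu]_(x in [set: R] `\ 0%R) \int[mu]_m K (x, m)); last exact: punctured.
  apply: eq_integral => x; rewrite inE /= => -[_ /eqP x0].
  rewrite [LHS](@ge0_integral_scale _ x (fun y => (EFin \o h) (x, y)) x0
    (measurable_fun_pair2 x mH) (fun y => H0 (x, y))).
  rewrite -ge0_integralZl_EFin//.
  apply: (measurableT_comp (measurable_fun_pair2 x mH)).
  exact: measurable_funM.
rewrite fubini_tonelli//.
transitivity (\int[mu]_m \int[mu]_r fin_kernel (r, m)).
  (* In the scaling x = c r, the factor c of dx and the factor |c r| of [K] combine to |r| c^2 = |r|
     / (1 + m^2), the polar Jacobian. *)
  apply: eq_integral => m _; pose c := cos (atan m).
  have c0 : (0 < c)%R by rewrite /c cos_atan invr_gt0 sqrtr_gt0 ltr_pwDl// sqr_ge0.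
  have c_neq0 : c != 0%R by rewrite gt_eqF.
  rewrite [LHS](@ge0_integral_scale _ c (fun x => K (x, m)) c_neq0
    (measurable_fun_pair1 m mK) (fun x => K0 (x, m))).
  rewrite -ge0_integralZl_EFin//; last first.
    apply: (measurableT_comp (measurable_fun_pair1 m mK)).
    exact: measurable_funM.
  apply: eq_integral => r _; rewrite /K /fin_kernel /polar_kernel /angular_kernel /= -EFinM; congr (_%:E).
  have cm : sin (atan m) = (c * m)%R.
    by rewrite -{2}(atanK m) /tan /c mulrCA mulfV ?mulr1// gt_eqF.
  have c2 : ((1 + m ^+ 2)^-1 = c * c)%R.
    by rewrite /c cos_atan -expr2 exprVn sqr_sqrtr// addr_ge0// sqr_ge0.
  rewrite -/c cm c2 normrM (gtr0_norm c0).
  have -> : (r * (c * m) = c * r * m)%R by ring.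
  have -> : (r * c = c * r)%R by ring.
  ring.
rewrite -fubini_tonelli//; apply: eq_integral => r _; exact: polar_kernel_integral.
Qed.

Let measurable_signed_radial : measurable_fun setT (fun r : R => `|r|%:E * half_circle r).
Proof.
have := measurable_fun_fubini_tonelli_F (m2 := mu) _ measurable_fin_kernel fin_kernel_ge0.
rewrite (_ : fubini_F _ _ = (fun r : R => `|r|%:E * half_circle r))//.
by apply/funext => r; exact: polar_kernel_integral.
Qed.

Let half_circle_ge0 r : 0 <= half_circle r.
Proof. by apply: integral_ge0 => t _; rewrite lee_fin. Qed.

(** Replacing r by - r rotates by pi, which turns the right half circle into the left one. *)
Let full_circle r : half_circle (- r) + half_circle r =
  \int[mu]_(t in `[(- (pi / 2))%R, (- (pi / 2) + 2 * pi)%R]) (h (r * cos t, r * sin t)%R)%:E.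
Proof.
pose g t := (h (r * cos t, r * sin t)%R)%:E.
have cg := @h_circle r.
have mg : measurable_fun setT g by apply/measurable_EFinP; exact: continuous_measurable_fun cg.
have g0 t : 0 <= g t by rewrite lee_fin.
have pi0 := pi_gt0 R.
rewrite addeC.
have -> : half_circle r = \int[mu]_(t in `[(- (pi / 2))%R, (pi / 2)%R]) g t.
  by rewrite integral_itv_bndoo//; exact: measurable_funTS.
have -> : half_circle (- r) = \int[mu]_(t in `](pi / 2)%R, (- (pi / 2) + 2 * pi)%R]) g t.
  rewrite [RHS]integral_itv_bndoo//; last exact: measurable_funTS.
  rewrite /half_circle integral_mkcond [RHS]integral_mkcond.
  rewrite [RHS](ge0_integral_shift pi).
  - apply: eq_integral => t _; rewrite !patchE.
    have -> : ((t + pi)%R \in `](pi / 2)%R, (- (pi / 2) + 2 * pi)%R[%classic) =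
        (t \in `](- (pi / 2))%R, (pi / 2)%R[%classic).
      rewrite !mem_setE !in_itv /=; congr andb; apply/idP/idP; lra.
    by rewrite /g cosDpi sinDpi !mulrN !mulNr.
  - by apply/(measurable_restrictT _ _).1 => //; exact: measurable_funTS.
  - by move=> t; apply: erestrict_ge0.
rewrite -ge0_integral_setU//=.
- by congr (integral _ _ _); rewrite -itv_bndbnd_setU// bnd_simp; lra.
- exact: measurable_funTS.
- rewrite disj_set2E; apply/eqP; rewrite -subset0 => t [] /=; rewrite !in_itv /=.
  by move=> /andP[_ t1] /andP[t2 _]; move: (lt_le_trans t2 t1); rewrite ltxx.
Qed.

Lemma measurable_circle_integral : measurable_fun setT (fun r : R =>
  \int[mu]_(t in `[(- (pi / 2))%R, (- (pi / 2) + 2 * pi)%R]) (h (r * cos t, r * sin t)%R)%:E).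
Proof.
have mang : measurable_fun setT (EFin \o angular_kernel) by exact/measurable_EFinP.
have ang0 p : 0 <= (EFin \o angular_kernel) p by rewrite lee_fin.
have mhalf : measurable_fun setT half_circle.
  have := measurable_fun_fubini_tonelli_F (m2 := mu) _ mang ang0.
  rewrite (_ : fubini_F _ _ = half_circle)//; apply/funext => r.
  by rewrite /half_circle -(@tan_substitution _ (fun t => h (r * cos t, r * sin t)%R)).
rewrite (_ : (fun r : R => _) = (fun r : R => half_circle (- r)%R + half_circle r)).
  apply: emeasurable_funD => //.
  by apply: (measurableT_comp mhalf); exact: oppr_measurable.
by apply/funext => r; rewrite full_circle.
Qed.

Lemma polar_coordinates : \int[mu \x mu]_p (h p)%:E = \int[mu]_(r in `]0%R, +oo[)
  (r%:E * \int[mu]_(t in `[(- (pi / 2))%R, (- (pi / 2) + 2 * pi)%R])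
    (h (r * cos t, r * sin t)%R)%:E).
Proof.
rewrite polar_coordinates_line; set F := fun r : R => `|r|%:E * half_circle r.
have mF : measurable_fun setT F := measurable_signed_radial.
have F0 r : 0 <= F r by rewrite mule_ge0.
have mFN : measurable_fun setT (fun r : R => F (- r)%R).
  by apply: (measurableT_comp mF); exact: oppr_measurable.
(* Negative radii are folded onto positive ones, where they supply the missing half circles. *)
have -> : \int[mu]_r F r = \int[mu]_(r in `]0%R, +oo[) (F (- r)%R + F r).
  rewrite ge0_integralD//; last 2 first.
  - exact: measurable_funTS.
  - exact: measurable_funTS.
  rewrite integral_itv_obnd_cbnd; last exact: measurable_funTS.
  rewrite (@ge0_integration_by_substitution0 _ (fun r => F (- r)%R))//.
  under [X in _ = X + _]eq_integral do rewrite opprK.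
  rewrite -ge0_integral_setU//=.
  - by rewrite -itv_bndbnd_setU// ?bnd_simp// set_itvNyy.
  - exact: measurable_funTS.
  - rewrite disj_set2E; apply/eqP; rewrite -subset0 => t [] /=; rewrite !in_itv /= andbT.
    by move=> t1 t2; move: (lt_le_trans t2 t1); rewrite ltxx.
apply: eq_integral => r; rewrite inE /= in_itv /= andbT => r0.
by rewrite /F normrN gtr0_norm// -ge0_muleDr// full_circle.
Qed.

End Polar.

(** * The domains and the main estimate *)

Section Domains.
Variable R : realType.
Implicit Types (p q : R * R) (x : R).

Definition point p : R[i] := p.1 +i* p.2.

(* The two halves of the sum are centred at x and at 1 - x. *)
Definition center (b : bool) x : R := if b then x else 1 - x.

Lemma cmod_point_sub p (k : R) : cmod (point p - k%:C) ^+ 2 = (p.1 - k) ^+ 2 + p.2 ^+ 2.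
Proof. by rewrite cmod_sqr Re_add Im_add Re_opp Im_opp /= subr0. Qed.

Lemma cmod_point_le p q : cmod (point p - point q) <= `|p.1 - q.1| + `|p.2 - q.2|.
Proof. by apply: le_trans (cmod_le_ReIm _) _; rewrite Re_add Im_add Re_opp Im_opp. Qed.

Lemma squareD_open p : squareD R (point p) -> exists2 d : R, 0 < d & forall q,
  `|q.1 - p.1| < d -> `|q.2 - p.2| < d -> squareD R (point q).
Proof.
rewrite /squareD /= => Dp.
exists ((2^-1 - (`|p.1 - 2^-1| + `|p.2|)) / 2); first by rewrite divr_gt0// subr_gt0.
move=> q q1 q2.
have := ler_normD (q.1 - p.1) (p.1 - 2^-1); rewrite addrA subrK => n1.
have := ler_normD (q.2 - p.2) p.2; rewrite subrK => n2.
lra.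
Qed.

Lemma disk_open (c : R[i]) (r : R) p : disk c r (point p) -> exists2 d : R, 0 < d & forall q,
  `|q.1 - p.1| < d -> `|q.2 - p.2| < d -> disk c r (point q).
Proof.
rewrite /disk /= => Dp; exists ((r - cmod (point p - c)) / 2).
  by rewrite divr_gt0// subr_gt0.
move=> q q1 q2; have -> : point q - c = (point q - point p) + (point p - c) by ring.
apply: le_lt_trans (cmodD _ _) _; have := cmod_point_le q p; lra.
Qed.

Lemma Omega_open p : Omega R (point p) -> exists2 d : R, 0 < d & forall q,
  `|q.1 - p.1| < d -> `|q.2 - p.2| < d -> Omega R (point q).
Proof.
by case=> -[x xP /disk_open[d d0 dP]]; exists d => // q q1 q2; [left|right];
  exists x => //; exact: dP.
Qed.

(** By Cauchy-Schwarz |u| + |v| <= sqrt 2 |u + i v| < x, while the centre is at distance 1/2 - x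
    from 1/2. The radius x / sqrt 2 is the distance from the centre to the nearest sides of the
    square. *)
Lemma disk_sub_squareD (b : bool) x z : 0 < x -> x <= 2^-1 ->
  disk (center b x)%:C (x / Num.sqrt 2) z -> squareD R z.
Proof.
move=> x0 x2; rewrite /disk /squareD /= => zx.
set u := complex.Re z - center b x; set v := complex.Im z.
have uv : u ^+ 2 + v ^+ 2 < x ^+ 2 / 2.
  have -> : u ^+ 2 + v ^+ 2 = cmod (z - (center b x)%:C) ^+ 2.
    by rewrite cmod_sqr Re_add Im_add Re_opp Im_opp /= subr0.
  have -> : x ^+ 2 / 2 = (x / Num.sqrt 2) ^+ 2 by rewrite expr_div_n sqr_sqrtr.
  by rewrite ltrXn2r// ?nnegrE ?cmod_ge0// divr_ge0 ?sqrtr_ge0// ltW.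
have uvx : `|u| + `|v| < x.
  rewrite -(ltr_pXn2r (n := 2)) ?nnegrE ?addr_ge0 ?(ltW x0)//.
  have := sqr_ge0 (`|u| - `|v|); move: uv.
  rewrite -(real_normK (num_real u)) -(real_normK (num_real v)); nra.
have cx : `|center b x - 2^-1| = 2^-1 - x.
  by case: b {zx u uv uvx} => /=; [rewrite ler0_norm ?subr_le0//; ring|
    rewrite ger0_norm; lra].
have := ler_normD u (center b x - 2^-1).
rewrite (_ : u + _ = complex.Re z - 2^-1); last by rewrite /u; ring.
rewrite cx => n1; lra.
Qed.

(** The inequality x < 1/2 is strict because the second family of disks in [Omega] has centres
    strictly to the right of 1/2. *)
Lemma disk_sub_Omega (b : bool) x z : 0 < x -> x < 2^-1 ->
  disk (center b x)%:C (x / Num.sqrt 2) z -> Omega R z.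
Proof.
move=> x0 x2; case: b => /= zx.
  by left; exists x => //=; rewrite x0 ltW.
right; exists (1 - x); last by rewrite /= subKr.
by rewrite /=; apply/andP; split; lra.
Qed.

Lemma Omega_sub_squareD z : Omega R z -> squareD R z.
Proof.
case=> -[x /= /andP[x0 x1]].
  exact: (@disk_sub_squareD true).
move=> zx; apply: (@disk_sub_squareD false (1 - x)); rewrite /= ?subKr//; lra.
Qed.

Lemma weight_support (b : bool) x p : 0 < x ->
  0 < x ^+ 2 - 2 * ((p.1 - center b x) ^+ 2 + p.2 ^+ 2) ->
  disk (center b x)%:C (x / Num.sqrt 2) (point p).
Proof.
move=> x0 w0; rewrite /disk /=.
rewrite -(ltr_pXn2r (n := 2)) ?nnegrE ?cmod_ge0 ?divr_ge0 ?sqrtr_ge0 ?(ltW x0)//.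
rewrite cmod_point_sub expr_div_n sqr_sqrtr//; lra.
Qed.

(* As a function of x, the weight is an arcsine density around
   2 (center b Re z). *)
Lemma weight_arcsine (b : bool) x p :
  x ^+ 2 - 2 * ((p.1 - center b x) ^+ 2 + p.2 ^+ 2) =
  2 * center b p.1 ^+ 2 - 2 * p.2 ^+ 2 - (x - 2 * center b p.1) ^+ 2.
Proof. by case: b => /=; ring. Qed.

End Domains.

(* An alias of the product measure: on [mu \x mu] itself the canonical
   sigma-finite structure is not inferred. *)
Definition plane_measure (R : realType) : set (measurableTypeR R * measurableTypeR R)%type -> \bar R :=
  (@lebesgue_measure R \x @lebesgue_measure R)%E.

HB.instance Definition _ (R : realType) := Measure.copy (@plane_measure R)
  (@lebesgue_measure R \x @lebesgue_measure R)%E.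

Lemma plane_measure_sigma_finite (R : realType) : sigma_finite setT (@plane_measure R).
Proof.
have /sigma_finiteP[F [TF ndF Foo]] := sigma_finiteT (@lebesgue_measure R).
exists (fun n => F n `*` F n).
  rewrite -setXTT TF predeqE => -[x y]; split=> [[/= [n _ Fx] [m _ Fy]]|[n _ [/= Fx Fy]]].
    exists (maxn n m) => //; split.
      by move: x Fx; exact/subsetPset/ndF/leq_maxl.
    by move: y Fy; exact/subsetPset/ndF/leq_maxr.
  by split; exists n.
move=> n; have [mF Ffin] := Foo n; split; first exact: measurableX.
by rewrite /plane_measure product_measure1E// lte_mul_pinfty// ge0_fin_numE.
Qed.

HB.instance Definition _ (R : realType) :=
  Measure_isSigmaFinite.Build _ _ _ (@plane_measure R) (@plane_measure_sigma_finite R).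

(** * The weighted estimate and its integration over the centres *)

Section BergmanOmega.
Variables (R : realType) (f : R[i] -> R[i]).
Hypothesis f_holo : holomorphic_on (squareD R) f.
Notation mu := (@lebesgue_measure R).
Implicit Types (p q : R * R) (x : R).

Let f_cderiv z : squareD R z -> exists L, has_cderiv f z L.
Proof. by move=> /f_holo; exact: derivable_has_cderiv. Qed.

(** Off the square the values of f are arbitrary; extension by 0 yields a function that is
    measurable on the whole plane. *)
Let density : R * R -> R :=
  (fun p => cmod (f (point p)) ^+ 2) \_ [set p | squareD R (point p)].

Let density_ge0 p : 0 <= density p.
Proof. by rewrite /density patchE; case: ifPn => // _; exact: sqr_ge0. Qed.

Let densityE p : squareD R (point p) -> density p = cmod (f (point p)) ^+ 2.
Proof. by move=> Dp; rewrite /density patchE mem_set. Qed.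

(** For y >= 0 the set where the density exceeds y is open: it lies in the open square, where f is
    continuous. For y < 0 it is the whole plane. *)
Let measurable_density : measurable_fun setT density.
Proof.
apply: (measurability _ (RGenOInfty.measurableE R)) => // _ [_ [y ->] <-].
rewrite setTI; have [y0|y0] := ltP y 0.
  rewrite (_ : _ @^-1` _ = setT)//; apply/seteqP; split=> // p _ /=.
  by rewrite in_itv /= andbT (lt_le_trans y0).
apply: open_box_measurable => p /=; rewrite in_itv /= andbT => yp.
have Dp : squareD R (point p).
  apply: contrapT => nD; move: yp; rewrite /density patchE memNset//=.
  by rewrite ltNge y0.
move: yp; rewrite densityE// => yp.
have [L fL] := f_cderiv Dp.
have e0 : 0 < cmod (f (point p)) - Num.sqrt y.
  rewrite subr_gt0 -(ltr_pXn2r (n := 2)) ?nnegrE ?cmod_ge0 ?sqrtr_ge0//.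
  by rewrite sqr_sqrtr.
have [d1 d10 H1] := has_cderiv_cont fL e0.
have [d2 d20 H2] := squareD_open Dp.
exists (Num.min (d1 / 2) d2); first by rewrite lt_min d20 divr_gt0.
move=> q; rewrite !lt_min => /andP[q1 q2] /andP[q3 q4].
rewrite in_itv /= andbT densityE; last exact: H2.
have : cmod (f (point q) - f (point p)) < cmod (f (point p)) - Num.sqrt y.
  apply: H1; apply: le_lt_trans (cmod_point_le q p) _; lra.
rewrite cmodBC => lt1.
have := cmodD (f (point p) - f (point q)) (f (point q)); rewrite subrK => le2.
have lt3 : Num.sqrt y < cmod (f (point q)) by lra.
by rewrite -[y in y < _]sqr_sqrtr// ltrXn2r// nnegrE ?sqrtr_ge0 ?cmod_ge0.
Qed.

Let squareD_circle (b : bool) x (r t : R) : 0 < x -> x <= 2^-1 -> 0 < x ^+ 2 - 2 * r ^+ 2 ->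
  squareD R ((center b x)%:C + r%:C * cis t).
Proof.
move=> x0 x2 w0; apply: (disk_sub_squareD (b := b) x0 x2).
rewrite /disk /= addrC addKr cmodM cmod_cis mulr1 cmod_real.
rewrite -(ltr_pXn2r (n := 2)) ?nnegrE ?divr_ge0 ?sqrtr_ge0 ?(ltW x0)//.
by rewrite real_normK ?num_real// expr_div_n sqr_sqrtr//; lra.
Qed.

Let circle_point (k r t : R) : k%:C + r%:C * cis t = point (r * cos t + k, r * sin t).
Proof.
by apply: complex_ext; rewrite ?Re_add ?Im_add ?Re_mul ?Im_mul /=; ring.
Qed.

Let weight (b : bool) (x : R) p : R :=
  inv_sqrt (x ^+ 2 - 2 * ((p.1 - center b x) ^+ 2 + p.2 ^+ 2)).

Definition bergman_coefficient (b : bool) n x : R :=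
  2 ^+ n / (n.*2.+1)`!%:R * (x ^+ n.*2.+1 * cmod (cderiv n f (center b x)%:C) ^+ 2).

Let measurable_weight : forall b : bool,
  measurable_fun setT (fun xp : R * (R * R) => weight b xp.1 xp.2).
Proof.
move=> b; apply: measurableT_comp; first exact: measurable_inv_sqrt.
have m1 : measurable_fun [set: R * (R * R)] fst by exact: measurable_fst.
have m2 : measurable_fun [set: R * (R * R)] snd by exact: measurable_snd.
have m21 : measurable_fun [set: R * (R * R)] (fun xp => xp.2.1).
  by apply: (measurableT_comp _ m2); exact: measurable_fst.
have m22 : measurable_fun [set: R * (R * R)] (fun xp => xp.2.2).
  by apply: (measurableT_comp _ m2); exact: measurable_snd.
have mc : measurable_fun [set: R * (R * R)] (fun xp => center b xp.1).
  by case: b => //=; exact: measurable_funB.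
apply: measurable_funB; first exact: measurable_funX.
apply: measurable_funM => //; apply: measurable_funD; apply: measurable_funX => //.
exact: measurable_funB.
Qed.

(* Bessel's inequality on the circles around center b x, integrated against the
   weight r / sqrt(x^2 - 2 r^2) whose moments are n!^2 x^(2n+1) 2^(n-1) / (2n+1)!. *)
Let weighted_disk_bound (b : bool) x N : 0 < x -> x <= 2^-1 ->
  ((\sum_(n < N) bergman_coefficient b n x)%:E <=
   (pi^-1)%:E * \int[mu \x mu]_p (density p * weight b x p)%:E)%E.
Proof.
move=> x0 x2; set k := center b x.
pose h p := density (p.1 + k, p.2) * inv_sqrt (x ^+ 2 - 2 * (p.1 ^+ 2 + p.2 ^+ 2)).
have m1 : measurable_fun [set: R * R] fst by exact: measurable_fst.
have m2 : measurable_fun [set: R * R] snd by exact: measurable_snd.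
have mh : measurable_fun setT h.
  apply: measurable_funM.
    apply: measurableT_comp => //; apply: measurable_fun_pair => //.
    exact: measurable_funD.
  apply: measurableT_comp; first exact: measurable_inv_sqrt.
  apply: measurable_funB => //; apply: measurable_funM => //.
  by apply: measurable_funD; apply: measurable_funX.
have h0 p : 0 <= h p by rewrite mulr_ge0// inv_sqrt_ge0.
have radius r t : (r * cos t) ^+ 2 + (r * sin t) ^+ 2 = r ^+ 2 :> R.
  by rewrite !exprMn -mulrDr cos2Dsin2 mulr1.
have hE r t : 0 < x ^+ 2 - 2 * r ^+ 2 -> h (r * cos t, r * sin t) =
    inv_sqrt (x ^+ 2 - 2 * r ^+ 2) * cmod (f (k%:C + r%:C * cis t)) ^+ 2.
  move=> w0; rewrite /h /= radius mulrC circle_point densityE//.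
  by rewrite -circle_point; exact: squareD_circle.
have ccirc r : 0 < x ^+ 2 - 2 * r ^+ 2 -> ccont (fun t => f (k%:C + r%:C * cis t)).
  move=> w0; apply: ccont_comp => [|t]; last by apply: f_cderiv; exact: squareD_circle.
  by apply: ccontD; [exact: ccont_cst|apply: ccontZ; exact: ccont_cis].
have h_circle r : continuous (fun t => h (r * cos t, r * sin t)).
  have [w0|w0] := ltP 0 (x ^+ 2 - 2 * r ^+ 2).
    rewrite (_ : (fun _ => _) = (fun t => inv_sqrt (x ^+ 2 - 2 * r ^+ 2) *
        cmod (f (k%:C + r%:C * cis t)) ^+ 2)); last by apply/funext => t; exact: hE.
    move=> t; apply: (@continuousM R R (fun=> _) (fun t => cmod _ ^+ 2)).
      exact: cst_continuous.
    by apply: ccont_cmod2; exact: ccirc.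
  (* On circles of radius at least x / sqrt 2 the default value of [inv_sqrt] makes h vanish, even
     where the circle leaves the square. *)
  rewrite (_ : (fun _ => _) = (fun=> 0)); first exact: cst_continuous.
  by apply/funext => t; rewrite /h /= radius inv_sqrt_le0// mulr0.
pose dw p := density p * weight b x p.
(* Polar coordinates are centred at 0, so the real centre is first moved there by a shift of the
   first coordinate under Tonelli. *)
have translate : (\int[mu \x mu]_p (dw p)%:E = \int[mu \x mu]_p (h p)%:E)%E.
  have mw : measurable_fun setT (EFin \o dw).
    apply/measurable_EFinP; apply: measurable_funM => //.
    exact: (measurable_fun_pair2 x (measurable_weight b)).
  have w0 p : (0 <= (EFin \o dw) p)%E.
    by rewrite lee_fin mulr_ge0// inv_sqrt_ge0.
  have mh' : measurable_fun setT (EFin \o h) by exact/measurable_EFinP.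
  have h0' p : (0 <= (EFin \o h) p)%E by rewrite lee_fin.
  transitivity (\int[mu]_y \int[mu]_u (EFin \o dw) (u, y))%E.
    exact: (@fubini_tonelli2 _ _ _ _ _ mu mu _ mw w0).
  transitivity (\int[mu]_y \int[mu]_u (EFin \o h) (u, y))%E; last first.
    by symmetry; exact: (@fubini_tonelli2 _ _ _ _ _ mu mu _ mh' h0').
  apply: eq_integral => y _.
  rewrite [LHS](ge0_integral_shift k (measurable_fun_pair1 y mw) (fun u => w0 (u, y))).
  by apply: eq_integral => u _; rewrite /h /dw /weight /= addrK.
rewrite -/dw translate (polar_coordinates mh h0 h_circle).
pose a n := cmod (cderiv n f k%:C) / n`!%:R.
pose rho := x / Num.sqrt 2.
have rho_in r : 0 < r -> r < rho -> 0 < x ^+ 2 - 2 * r ^+ 2.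
  move=> r0 rrho; rewrite subr_gt0.
  have -> : x ^+ 2 = 2 * rho ^+ 2 by rewrite /rho expr_div_n sqr_sqrtr//; field.
  by rewrite ltr_pM2l// ltrXn2r// ?nnegrE ltW// (lt_trans r0).
pose moment n r := r ^+ n.*2.+1 * inv_sqrt (x ^+ 2 - 2 * r ^+ 2).
have mmoment n : measurable_fun setT (moment n).
  apply: measurable_funM; first exact: exprn_measurable.
  apply: measurableT_comp; first exact: measurable_inv_sqrt.
  apply: measurable_funB => //; apply: measurable_funM => //; exact: measurable_funX.
have circle_ge r : 0 < r -> r < rho ->
    (\sum_(n < N) (2 * pi * a n ^+ 2)%:E * (moment n r)%:E <=
     r%:E * \int[mu]_(t in `[(- (pi / 2))%R, (- (pi / 2) + 2 * pi)%R])
       (h (r * cos t, r * sin t)%R)%:E)%E.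
  move=> r0 rrho; have w0 := rho_in _ r0 rrho.
  have cc := ccont_cmod2 (ccirc _ w0).
  pose g t := cmod (f (k%:C + r%:C * cis t)) ^+ 2.
  have W0 := inv_sqrt_ge0 (x ^+ 2 - 2 * r ^+ 2).
  have -> : (\int[mu]_(t in `[(- (pi / 2))%R, (- (pi / 2) + 2 * pi)%R])
       (h (r * cos t, r * sin t)%R)%:E = (inv_sqrt (x ^+ 2 - 2 * r ^+ 2))%:E *
       (\int[mu]_(t in `[(- (pi / 2))%R, (- (pi / 2) + 2 * pi)%R]) g t)%R%:E)%E.
    rewrite fineK; last first.
      by apply: integrable_fin_num => //; exact: continuous_integrable.
    rewrite -ge0_integralZl_EFin//.
    - by apply: eq_integral => t _; rewrite (hE _ _ w0).
    - by move=> t _; rewrite lee_fin sqr_ge0.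
    - apply/measurable_EFinP; apply: measurable_funTS.
      exact: continuous_measurable_fun.
  have in_disk w : cmod (w - k%:C) <= r -> exists L, has_cderiv f w L.
    move=> wr; apply: f_cderiv; apply: (disk_sub_squareD (b := b) x0 x2).
    exact: le_lt_trans wr rrho.
  have := circle_derivative_bound (- (pi / 2)) N r0 in_disk; rewrite -/(g _) => bound.
  under eq_bigr do rewrite -EFinM.
  rewrite sumEFin -!EFinM lee_fin.
  have -> : \sum_(n < N) 2 * pi * a n ^+ 2 * moment n r =
      r * (inv_sqrt (x ^+ 2 - 2 * r ^+ 2) *
        (2 * pi * \sum_(n < N) (cmod (cderiv n f k%:C) / n`!%:R * r ^+ n) ^+ 2)).
    rewrite !mulr_sumr; apply: eq_bigr => n _; rewrite /moment.
    have -> : r ^+ n.*2.+1 = r * (r ^+ n) ^+ 2 by rewrite -exprM muln2 exprS.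
    by rewrite /a; ring.
  by rewrite ler_wpM2l ?(ltW r0)// ler_wpM2l.
have pi0 := pi_gt0 R.
have rho0 : 0 < rho by rewrite divr_gt0// sqrtr_gt0.
pose radial_integral r := (r%:E * \int[mu]_(t in `[(- (pi / 2))%R, (- (pi / 2) + 2 * pi)%R])
       (h (r * cos t, r * sin t)%R)%:E)%E.
have mradial : measurable_fun setT radial_integral.
  apply: emeasurable_funM; first exact/measurable_EFinP.
  exact: measurable_circle_integral.
have radial0 r : 0 <= r -> (0 <= radial_integral r)%E.
  by move=> r0; rewrite mule_ge0 ?lee_fin// integral_ge0// => t _; rewrite lee_fin.
rewrite -/radial_integral.
pose kappa n : R := 2 ^+ n * x ^+ n.*2.+1 * n`!%:R ^+ 2 / (n.*2.+1)`!%:R / 2.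
(* The n!^2 of the moment cancels the squared n! of the Taylor coefficient [a], and 1/pi * 2 pi *
   1/2 = 1. *)
have -> : \sum_(n < N) bergman_coefficient b n x = pi^-1 * \sum_(n < N) 2 * pi * a n ^+ 2 * kappa n.
  rewrite mulr_sumr; apply: eq_bigr => n _; rewrite /bergman_coefficient /kappa /a -/k.
  have n0 : n`!%:R != 0 :> R by rewrite pnatr_eq0 -lt0n fact_gt0.
  have n1 : (n.*2.+1)`!%:R != 0 :> R by rewrite pnatr_eq0 -lt0n fact_gt0.
  move: (pi) pi0 => p p0; field; by rewrite n0 n1 gt_eqF.
rewrite EFinM lee_wpmul2l ?lee_fin ?invr_ge0 ?(ltW pi0)//.
have a0 n : 0 <= 2 * pi * a n ^+ 2 by rewrite mulr_ge0 ?sqr_ge0// mulr_ge0// ltW.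
have in_rho r : r \in `]0, rho[ -> 0 < r /\ r < rho by rewrite in_itv /= => /andP[].
have moment0 n r : r \in `]0, rho[ -> 0 <= moment n r.
  by move=> rP; have [r0 _] := in_rho r rP; rewrite mulr_ge0 ?exprn_ge0 ?inv_sqrt_ge0// ltW.
apply: (@le_trans _ _ (\int[mu]_(r in `]0%R, rho[)
    (\sum_(n < N) (2 * pi * a n ^+ 2)%:E * (moment n r)%:E))%E).
  rewrite ge0_integral_sum//; last 2 first.
  - move=> n; apply: measurable_funeM; apply/measurable_EFinP; exact: (measurable_funTS (mmoment n)).
  - by move=> n r rP; rewrite mule_ge0 ?lee_fin ?moment0.
  rewrite -sumEFin; apply: lee_sum => n _; rewrite ge0_integralZl_EFin//; last 2 first.
  - by move=> r rP; rewrite lee_fin moment0.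
  - by apply/measurable_EFinP; exact: (measurable_funTS (mmoment n)).
  by rewrite EFinM lee_wpmul2l ?lee_fin//; exact: radial_moment.
apply: (@le_trans _ _ (\int[mu]_(r in `]0%R, rho[) radial_integral r)%E).
  apply: ge0_le_integral => //.
  - by move=> r rP; apply: sume_ge0 => n _; rewrite mule_ge0 ?lee_fin ?moment0.
  - apply: emeasurable_sum => n; apply: measurable_funeM; apply/measurable_EFinP.
    exact: (measurable_funTS (mmoment n)).
  - exact: (measurable_funTS mradial).
  - by move=> r rP; have [r0 rrho] := in_rho r rP; exact: circle_ge.
apply: ge0_subset_integral => //.
- exact: (measurable_funTS mradial).
- by move=> r /=; rewrite in_itv /= andbT => /ltW; exact: radial0.
- by move=> r /=; rewrite !in_itv /= andbT => /andP[].
Qed.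

(** Each derivative is again complex differentiable, hence continuous at the moving centre. This is
    what makes the coefficients measurable in x. *)
Let continuous_coefficient (b : bool) n x : 0 < x < 2^-1 ->
  {for x, continuous (bergman_coefficient b n)}.
Proof.
move=> /andP[x0 x2]; pose r := x / Num.sqrt 2 / 2.
have rho0 : 0 < x / Num.sqrt 2 by rewrite divr_gt0// sqrtr_gt0.
have r0 : 0 < r by rewrite divr_gt0.
have in_disk w : cmod (w - (center b x)%:C) <= r -> exists L, has_cderiv f w L.
  move=> wr; apply: f_cderiv; apply: (disk_sub_squareD (b := b) x0 (ltW x2)).
  by rewrite /disk /=; apply: le_lt_trans wr _; rewrite /r; lra.
have [|_ /has_cderiv_cont cont] := @cauchy_derivatives _ 0 _ _ _ in_disk n (center b x)%:C.
  by rewrite subrr cmod0.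
pose D y := cmod (cderiv n f (center b y)%:C).
have cD : {for x, continuous D}.
  apply/cvgrPdist_lt => e e0; have [d d0 Hd] := cont _ e0.
  exists d => // y /=; rewrite distrC => xy.
  have : cmod ((center b y)%:C - (center b x)%:C) < d.
    rewrite -rmorphB cmod_real; move: xy; case: (b) => //=.
    by rewrite (_ : 1 - y - (1 - x) = x - y) 1?distrC//; ring.
  move=> /Hd; apply: le_lt_trans; rewrite /D ler_norml.
  set u := cderiv _ _ _; set v := cderiv _ _ _.
  have := cmodD (u - v) v; have := cmodD (v - u) u.
  rewrite !subrK [cmod (u - v)]cmodBC => ? ?; apply/andP; split; lra.
apply: (@continuousM R R (fun=> _) (fun y => y ^+ _ * D y ^+ 2)); first exact: cst_continuous.
apply: (@continuousM R R (fun y => y ^+ _) (fun y => D y ^+ 2)); first exact: exprn_continuous.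
by apply: (@continuous_comp _ _ _ D (fun y => y ^+ 2)); [exact: cD|exact: exprn_continuous].
Qed.

Lemma measurable_coefficient (b : bool) n : measurable_fun (`]0, 2^-1[%classic : set R) (bergman_coefficient b n).
Proof. by apply: continuous_oo_measurable => x; exact: continuous_coefficient. Qed.

Lemma coefficient_ge0 (b : bool) n x : 0 <= x -> 0 <= bergman_coefficient b n x.
Proof.
move=> x0; rewrite mulr_ge0 ?divr_ge0 ?exprn_ge0//.
by rewrite mulr_ge0 ?sqr_ge0 ?exprn_ge0.
Qed.

Definition plane_set (U : set R[i]) : set (R * R) := [set p | U (point p)].

Lemma measurable_Omega : measurable (plane_set (Omega R)).
Proof. by apply: open_box_measurable => p; exact: Omega_open. Qed.

Lemma measurable_squareD : measurable (plane_set (squareD R)).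
Proof. by apply: open_box_measurable => p; exact: squareD_open. Qed.

Lemma measurable_cmod2 :
  measurable_fun (plane_set (squareD R)) (fun p => cmod (f (point p)) ^+ 2).
Proof. exact/(measurable_restrictT _ measurable_squareD). Qed.

Lemma coefficient_sum_le (b : bool) N :
  (\int[mu]_(x in `]0%R, 2^-1%R[) (\sum_(n < N) bergman_coefficient b n x)%:E <=
   area_integral (Omega R) (fun z => (cmod (f z) ^+ 2)%R))%E.
Proof.
set I : set R := `]0, 2^-1[%classic.
have pi0 := pi_gt0 R.
have mI : measurable I by exact: measurable_itv.
have in_I x : I x -> 0 < x /\ x < 2^-1 by rewrite /I /= in_itv /= => /andP[].
(* The indicator extends the integral over x to the whole line, so that Tonelli applies on the full
   product of the line with the plane. *)
pose Q (xp : R * (R * R)) := \1_I xp.1 * (density xp.2 * weight b xp.1 xp.2).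
have Q0 xp : 0 <= Q xp.
  by rewrite mulr_ge0 ?indicE// mulr_ge0// inv_sqrt_ge0.
have mQ : measurable_fun setT Q.
  apply: measurable_funM.
    by apply: (measurableT_comp (f := \1_I : R -> R)); [exact: measurable_indic|exact: measurable_fst].
  apply: measurable_funM; last exact: measurable_weight.
  by apply: measurableT_comp; [exact: measurable_density|exact: measurable_snd].
have mQ' : measurable_fun setT (EFin \o Q) by exact/measurable_EFinP.
have Q0' xp : (0 <= (EFin \o Q) xp)%E by rewrite lee_fin.
pose dOm := (fun p => cmod (f (point p)) ^+ 2) \_ (plane_set (Omega R)).
have dOm0 p : 0 <= dOm p by rewrite /dOm patchE; case: ifPn => // _; exact: sqr_ge0.
have mdOm : measurable_fun setT dOm.
  apply/(measurable_restrictT _ measurable_Omega).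
  apply: measurable_funS measurable_cmod2; first exact: measurable_squareD.
  by move=> p; exact: Omega_sub_squareD.
have -> : area_integral (Omega R) (fun z => (cmod (f z) ^+ 2)%R) =
    (\int[mu \x mu]_p (dOm p)%:E)%E.
  rewrite /area_integral integral_mkcond; apply: eq_integral => p _.
  by rewrite /dOm !patchE; case: ifP.
have mF : measurable_fun setT (fun x => \int[mu \x mu]_p (EFin \o Q) (x, p))%E.
  exact: (measurable_fun_fubini_tonelli_F (m2 := @plane_measure R) _ mQ' Q0').
have mG : measurable_fun setT (fun p => \int[mu]_x (EFin \o Q) (x, p))%E.
  exact: (measurable_fun_fubini_tonelli_G (m1 := mu) (T2 := (R * R)%type) _ mQ' Q0').
apply: (@le_trans _ _ (\int[mu]_(x in I) ((pi^-1)%:E *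
    \int[mu \x mu]_p (EFin \o Q) (x, p)))%E).
  apply: ge0_le_integral => //.
  - move=> x Ix; have [x0 _] := in_I x Ix.
    by rewrite lee_fin sumr_ge0// => n _; rewrite coefficient_ge0// ltW.
  - apply/measurable_EFinP; apply: measurable_sum => n; exact: measurable_coefficient.
  - by apply: measurable_funeM; apply: measurable_funTS; exact: mF.
  - move=> x Ix; have [x0 x2] := in_I x Ix.
    apply: le_trans (weighted_disk_bound b N x0 (ltW x2)) _.
    rewrite lee_wpmul2l ?lee_fin ?invr_ge0 ?(ltW pi0)// le_eqVlt; apply/orP; left; apply/eqP.
    by apply: eq_integral => p _; rewrite /Q /= indicE mem_set// mul1r.
rewrite ge0_integralZl_EFin//; last 3 first.
- by move=> x _; exact: integral_ge0.
- by apply: measurable_funTS; exact: mF.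
- by rewrite invr_ge0 ltW.
have -> : (\int[mu]_(x in I) \int[mu \x mu]_p (EFin \o Q) (x, p) =
    \int[mu]_x \int[mu \x mu]_p (EFin \o Q) (x, p))%E.
  rewrite integral_mkcond; apply: eq_integral => x _; rewrite patchE.
  case: ifPn => // xI; symmetry; apply: integral0_eq => p _.
  by rewrite /Q /= indicE (negPf xI) mul0r.
have -> : (\int[mu]_x \int[mu \x mu]_p (EFin \o Q) (x, p) =
    \int[mu \x mu]_p \int[mu]_x (EFin \o Q) (x, p))%E.
  exact: (fubini_tonelli (m1 := mu) (m2 := @plane_measure R) _ mQ' Q0').
apply: (@le_trans _ _ ((pi^-1)%:E * \int[mu \x mu]_p (pi%:E * (dOm p)%:E))%E).
  rewrite lee_wpmul2l ?lee_fin ?invr_ge0 ?(ltW pi0)//; apply: ge0_le_integral => //.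
  - by move=> p _; exact: integral_ge0.
  - by apply: measurable_funeM; exact/measurable_EFinP.
  (* A point outside [Omega] lies in none of the disks, so the weight takes its default value 0
     there for every x in [I]. This confines the final integral to [Omega]. *)
  move=> p _; have [Op|nOp] := pselect (Omega R (point p)); last first.
    rewrite integral0_eq ?mule_ge0 ?lee_fin ?(ltW pi0)// => x _.
    rewrite /Q /= indicE; have [/set_mem Ix|_] := boolP (x \in I); last by rewrite mul0r.
    have [x0 x2] := in_I x Ix; rewrite /weight inv_sqrt_le0 ?mulr0// leNgt.
    by apply/negP => /(weight_support x0)/(disk_sub_Omega x0 x2).
  have -> : dOm p = density p.
    by rewrite /dOm patchE mem_set// densityE//; exact: Omega_sub_squareD.
  have mw : measurable_fun setT (fun x => inv_sqrt
      (2 * center b p.1 ^+ 2 - 2 * p.2 ^+ 2 - (x - 2 * center b p.1) ^+ 2)).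
    apply: measurableT_comp; first exact: measurable_inv_sqrt.
    by apply: measurable_funB => //; apply: measurable_funX; exact: measurable_funB.
  have -> : (\int[mu]_x (EFin \o Q) (x, p) = (density p)%:E * \int[mu]_(x in I)
     (inv_sqrt (2 * center b p.1 ^+ 2 - 2 * p.2 ^+ 2 - (x - 2 * center b p.1) ^+ 2))%:E)%E.
    rewrite -ge0_integralZl_EFin//; last 2 first.
    - by move=> x _; rewrite lee_fin inv_sqrt_ge0.
    - by apply/measurable_EFinP; exact: (measurable_funTS mw).
    rewrite [RHS]integral_mkcond; apply: eq_integral => x _.
    rewrite patchE /Q /= indicE; case: ifPn => _; last by rewrite mul0r.
    by rewrite mul1r /weight weight_arcsine EFinM.
  by rewrite muleC lee_wpmul2r ?lee_fin//; exact: arcsine_integral.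
rewrite ge0_integralZl_EFin//; last 3 first.
- by move=> p _; rewrite lee_fin.
- exact/measurable_EFinP.
- exact: ltW.
by rewrite muleA -EFinM mulVf ?mul1e// gt_eqF.
Qed.

End BergmanOmega.

Theorem proposition3p1 (R : realType) (f : R[i] -> R[i])
    (hf : bergman (squareD R) f) :
  (\sum_(0 <= n <oo)
      ((2 ^+ n / ((n.*2.+1)`!)%:R)%R%:E *
       \int[lebesgue_measure]_(x in `[0%R, 2^-1%R])
         (x ^+ n.*2.+1 * (cmod (cderiv n f x%:C) ^+ 2
                          + cmod (cderiv n f (1 - x)%:C) ^+ 2))%R%:E)
   <= 2%:E * area_integral (Omega R) (fun z => (cmod (f z) ^+ 2)%R))%E
  /\
  (2%:E * area_integral (Omega R) (fun z => (cmod (f z) ^+ 2)%R)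
   <= 2%:E * area_integral (squareD R) (fun z => (cmod (f z) ^+ 2)%R))%E.
Proof.
have [f_holo _] := hf.
have mD := @measurable_squareD R; have mO := @measurable_Omega R.
split; last first.
  rewrite lee_wpmul2l// /area_integral; apply: ge0_subset_integral => //.
  - by apply/measurable_EFinP; exact: measurable_cmod2.
  - by move=> p _; rewrite lee_fin sqr_ge0.
  - by move=> p; exact: Omega_sub_squareD.
(* The interval is open because continuity of the coefficients is established only in its interior;
   the two endpoints removed are null. *)
pose T b n := (\int[lebesgue_measure]_(x in `]0%R, (2^-1)%R[)
  (bergman_coefficient f b n x)%:E)%E.
set M := area_integral _ _.
have in_I (x : R) : `]0, 2^-1[%classic x -> 0 <= x by rewrite /= in_itv /= => /andP[/ltW].
have sumT b N : (\sum_(n < N) T b n <= M)%E.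
  rewrite /T -ge0_integral_sum//.
  - under eq_integral do rewrite sumEFin.
    exact: coefficient_sum_le.
  - by move=> n; apply/measurable_EFinP; exact: measurable_coefficient.
  - by move=> n x Ix; rewrite lee_fin; apply: coefficient_ge0; exact: in_I.
have term n : ((2 ^+ n / ((n.*2.+1)`!)%:R)%R%:E *
       \int[lebesgue_measure]_(x in `[0%R, 2^-1%R])
         (x ^+ n.*2.+1 * (cmod (cderiv n f x%:C) ^+ 2
                          + cmod (cderiv n f (1 - x)%:C) ^+ 2))%R%:E)%E = (T true n + T false n)%E.
  set c : R := 2 ^+ n / _; pose g (x : R) := x ^+ n.*2.+1 *
    (cmod (cderiv n f x%:C) ^+ 2 + cmod (cderiv n f (1 - x)%:C) ^+ 2).
  have c0 : 0 < c by rewrite divr_gt0 ?exprn_gt0// ltr0n fact_gt0.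
  have gE x : c * g x = bergman_coefficient f true n x + bergman_coefficient f false n x.
    by rewrite /bergman_coefficient /g -/c /=; ring.
  have mt b := measurable_coefficient f_holo b n.
  have mg : measurable_fun (`]0, 2^-1[%classic : set R) g.
    rewrite (_ : g = (fun x => c^-1 * (bergman_coefficient f true n x +
        bergman_coefficient f false n x))).
      by apply: measurable_funM => //; exact: measurable_funD.
    by apply/funext => x; rewrite -gE mulKf// gt_eqF.
  rewrite integral_itv_bndoo; last exact/measurable_EFinP.
  rewrite -ge0_integralZl_EFin//; last 3 first.
  - move=> x /in_I x0; rewrite lee_fin mulr_ge0 ?exprn_ge0//.
    by rewrite addr_ge0// sqr_ge0.
  - exact/measurable_EFinP.
  - exact: ltW.
  rewrite /T -ge0_integralD//.
  - by apply: eq_integral => x _; rewrite -EFinM -EFinD -/(g x) gE.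
  - by move=> x /in_I x0; rewrite lee_fin coefficient_ge0.
  - by apply/measurable_EFinP; exact: mt.
  - by move=> x /in_I x0; rewrite lee_fin coefficient_ge0.
  - by apply/measurable_EFinP; exact: mt.
have T0 b n : (0 <= T b n)%E.
  by apply: integral_ge0 => x /in_I x0; rewrite lee_fin coefficient_ge0.
(* The terms are nonnegative, so it suffices to bound the partial sums; each splits into the two
   families of centres, and each family costs one copy of [M]. *)
apply: lime_le; first by apply: is_cvg_nneseries => n _ _; rewrite term adde_ge0.
apply: nearW => N; rewrite big_mkord (eq_bigr (fun n : 'I_N => T true n + T false n)%E) => [|n _ //].
rewrite big_split /= -[2%:E]/((1 + 1)%:E) EFinD ge0_muleDl ?lee_fin// mul1e.
by apply: leeD; exact: sumT.
Qed.
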